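(* Assume that $c<1/2$ and that there is $L>0$ such that $\|\nabla f(u)-\nabla f(v)\|\le L\|u-v\|$ for all $u,v\in\mathbb{R}^n$. Let $(x_k)_{k\ge0}$ be the iterates generated by the finite-difference algorithm described in the context from any initial point $x_0\in\mathbb{R}^n$. Put $$K:=\max\left(\frac{4\sqrt d\,\mathcal{C}n}{1-\epsilon},\ \frac{6\,\mathcal{C}nm^2}{d}\left(\frac{M_2}{M_1c}+1\right)\right)L,\qquad \bar\alpha:=\min\left(1,\frac{2\beta(1-2c)}{mM_2L}\right).$$ Then for any $\epsilon\in(0,1)$ with $p(\epsilon)>0$, any finite-difference precision $\varepsilon>0$ and every $k\ge0$, $$\mathbb{E}\left[\min_{0\le j\le k}\|\nabla f(x_j)\|\right]\le\sqrt{\frac1{k+1}\left(\frac{c\,\bar\alpha\,M_1\,p(\epsilon)}{4}\left(\frac{(1-\epsilon)d}{3\,\mathcal{C}n}\right)^2\right)^{-1}\bigl(f(x_0)-f^*\bigr)+K^2\varepsilon^2}.$$ If instead the precision decreases along the iterations, with precision $\varepsilon_k>0$ used at iteration $k$ and $\sum_{j\ge0}\varepsilon_j^2<\infty$, then for every $k\ge 0$ $$\mathbb{E}\left[\min_{0\le j\le k}\|\nabla f(x_j)\|\right]\le\sqrt{\frac1{k+1}\left(\frac{c\,\bar\alpha\,M_1\,p(\epsilon)}{4}\left(\frac{(1-\epsilon)d}{3\,\mathcal{C}n}\right)^2\right)^{-1}\bigl(f(x_0)-f^*\bigr)+\frac{K^2\sum_{j\ge0}\varepsilon_j^2}{k+1}},$$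 and hence in this case $\mathbb{E}\left[\min_{0\le j\le k}\|\nabla f(x_j)\|\right]=O\left(\sqrt{1/k}\right)$.
   Context: Notation: $\epsilon\in(0,1)$ (distortion of random projections) and $\varepsilon>0$ (finite-difference precision) are two different quantities. Setting. $f:\mathbb{R}^n\to\mathbb{R}$ is of class $C^2$ (not necessarily convex), and $f^*\in\mathbb{R}$ is the optimal value of $\min_{x\in\mathbb{R}^n}f(x)$. $\|\cdot\|$ is the Euclidean norm for vectors and the operator norm for matrices. $d,m$ are positive integers, much smaller than $n$, with $m$ even. Parameters: $\beta,c\in(0,1)$ and $0<M_1\le M_2$. For a matrix $A\in\mathbb{R}^{n\times r}$, with $e_1,\dots,e_r$ the canonical basis of $\mathbb{R}^r$, define $\nabla_{A,\varepsilon}f(x)\in\mathbb{R}^r$ by $$\nabla_{A,\varepsilon}f(x)_i=\frac{f(x+\varepsilon Ae_i)-f(x-\varepsilon Ae_i)}{2\varepsilon},\qquad 1\le i\le r.$$ Finite-difference algorithm. Input: a deterministic $x_0\in\mathbb{R}^n$, a symmetric matrix $H_0\in\mathbb{R}^{m\times m}$ with $M_1I_m\preceq H_0\preceq M_2I_m$, and an initial $n\times m$ matrix with normalized columns. For $k=0,1,2,\dots$ (with precision $\varepsilon$, replaced by $\varepsilon_k$ at iteration $k$ when the precision varies): 1. Sample $Q_k\in\mathbb{R}^{n\times d}$ with independent $N(0,1)$ entries, independent of everything generated before. 2. $P_k\in\mathbb{R}^{n\times m}$ has columns, in order for $j=k-\frac m2+1,\dots,k$, $\frac{x_j}{\|x_j\|}$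 and $\frac{Q_j\nabla_{Q_j,\varepsilon}f(x_j)}{\|Q_j\nabla_{Q_j,\varepsilon}f(x_j)\|}$, where any column with zero denominator is replaced by the zero vector. At each iteration the first two columns are dropped and the two new columns appended at the end; for early iterations, columns with negative indices are taken from the initial matrix. 3. $\mathbf{d}_k:=-H_k\nabla_{P_k,\varepsilon}f(x_k)$. 4. $\alpha_k:=\beta^i$, with $i\in\{0,1,2,\dots\}$ the smallest integer such that $f(x_k+\alpha_kP_k\mathbf{d}_k)\le f(x_k)+c\,\alpha_k\nabla_{P_k,\varepsilon}f(x_k)^\top\mathbf{d}_k$ (the line search is understood to terminate at every iteration). 5. $x_{k+1}:=x_k+\alpha_kP_k\mathbf{d}_k$. 6. With $s=\alpha_k\mathbf{d}_k$ and $y=\nabla_{P_k,\varepsilon}f(x_k+\alpha_kP_k\mathbf{d}_k)-\nabla_{P_k,\varepsilon}f(x_k)$, set $\tilde H_{k+1}:=\left(I-\frac{sy^\top}{s^\top y}\right)H_k\left(I-\frac{ys^\top}{s^\top y}\right)+\frac{ss^\top}{s^\top y}$. 7. $H_{k+1}$ is obtained from $\tilde H_{k+1}$ by replacing its eigenvalues larger than $M_2$ by $M_2$ and those smaller than $M_1$ by $M_1$, so $M_1I_m\preceq H_{k+1}\preceq M_2I_m$. (If $s^\top y=0$, $H_{k+1}$ is any symmetric matrix determined by the history and satisfying these bounds.) Constants. $\mathcal{C}_0>0$ and $\mathcal{C}>0$ are constants such that, for a random $Q\in\mathbb{R}^{n\times d}$ with independent $N(0,1)$ entries: (i) for every $\epsilon\in(0,1)$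 and $x\in\mathbb{R}^n$, $(1-\epsilon)\|x\|^2\le\|\frac1{\sqrt d}Q^\top x\|^2\le(1+\epsilon)\|x\|^2$ with probability at least $1-2e^{-\mathcal{C}_0\epsilon^2d}$; (ii) $\frac1d\|QQ^\top\|\le\mathcal{C}\frac nd$ with probability at least $1-2e^{-d}$. Set $p(\epsilon):=1-(2e^{-\mathcal{C}_0\epsilon^2d}+2e^{-d})$. Expectations are over all the matrices $Q_k$. *)

(* Defs.v *)
From HB Require Import structures.
From mathcomp Require Import all_boot all_order all_algebra.
From mathcomp Require Import all_classical all_reals all_analysis.

Set Implicit Arguments.
Unset Strict Implicit.
Unset Printing Implicit Defensive.

Import Order.TTheory GRing.Theory Num.Theory.
Import numFieldNormedType.Exports.

Local Open Scope classical_set_scope.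
Local Open Scope ring_scope.

Section euclidean.
Context {R : realType}.

Definition dotv n (u v : 'cV[R]_n) : R := \sum_i u i 0 * v i 0.

(* The norm `|_| of the library on matrices is the max norm: it only provides
   the topology of 'cV[R]_n, not the Euclidean norm. *)
Definition enorm n (u : 'cV[R]_n) : R := Num.sqrt (dotv u u).

Definition opnorm n r (A : 'M[R]_(n, r)) : R :=
  sup [set enorm (A *m v) | v in [set v : 'cV[R]_r | enorm v <= 1]].

(* As 0^-1 = 0, the zero vector is sent to itself. *)
Definition normalize n (u : 'cV[R]_n) : 'cV[R]_n := (enorm u)^-1 *: u.

Definition psd n (A : 'M[R]_n) : Prop :=
  A^T = A /\ forall v : 'cV[R]_n, 0 <= dotv v (A *m v).

Definition loewner_le n (A B : 'M[R]_n) : Prop := psd (B - A).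

Definition spectral_bounds n (M1 M2 : R) (A : 'M[R]_n) : Prop :=
  [/\ A^T = A, loewner_le M1%:M A & loewner_le A M2%:M].

(* B is obtained from the symmetric matrix A by moving the eigenvalues of A to
   the interval [M1, M2], in some orthonormal basis of eigenvectors of A; the
   result does not depend on the basis. *)
Definition eig_clip n (M1 M2 : R) (A B : 'M[R]_n) : Prop :=
  exists (U : 'M[R]_n) (lam : 'rV[R]_n),
    [/\ U^T *m U = 1%:M,
        A = U *m diag_mx lam *m U^T &
        B = U *m diag_mx (map_mx (fun t => Num.max M1 (Num.min M2 t)) lam)
              *m U^T].

End euclidean.

Section smoothness.
Context {R : realType} (n : nat).
Implicit Types f : 'cV[R]_n -> R.

Definition basis_vec (i : 'I_n) : 'cV[R]_n := delta_mx i 0.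

Definition partial f (i : 'I_n) : 'cV[R]_n -> R :=
  fun x => 'D_(basis_vec i) (f : 'cV[R]_n -> R^o) x.

Definition grad f (x : 'cV[R]_n) : 'cV[R]_n := \col_i partial f i x.

(* f is twice differentiable (in the sense of Frechet) and its second
   derivative is continuous. *)
Definition classC2 f : Prop :=
  [/\ forall x, differentiable (f : 'cV[R]_n -> R^o) x,
      forall i x, differentiable (partial f i : 'cV[R]_n -> R^o) x &
      forall i j, continuous (partial (partial f i) j)].

(* Central differences with precision h along the columns A e_i of A. *)
Definition fd_grad (h : R) f r (A : 'M[R]_(n, r)) (x : 'cV[R]_n) : 'cV[R]_r :=
  \col_i ((f (x + h *: col i A) - f (x - h *: col i A)) / (2 * h)).

End smoothness.

Section gaussian.
Context {R : realType} {disp : measure_display} {T : measurableType disp}.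
Variable P : probability T R.

(* Independence of the entries is the product rule over all of them; taking
   some of the sets equal to setT gives it for every subfamily. *)
Definition gaussian_matrix n d (Q : T -> 'M[R]_(n, d)) : Prop :=
  [/\ forall i j, measurable_fun [set: T] (fun w => Q w i j),
      forall i j (B : set R), measurable B ->
        P [set w | B (Q w i j)] = normal_prob 0 1 B &
      forall B : 'I_n -> 'I_d -> set R, (forall i j, measurable (B i j)) ->
        P [set w | forall i j, B i j (Q w i j)] =
        (\prod_(i < n) \prod_(j < d) fine (P [set w | B i j (Q w i j)]))%:E].

(* The sigma-algebra generated by the matrices Q_j for j in J. *)
Definition sigma_of n d (Q : nat -> T -> 'M[R]_(n, d)) (J : set nat) :
    set (set T) :=
  <<s [set A | exists j (i : 'I_n) (l : 'I_d) (B : set R),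
        [/\ J j, measurable B & A = [set w | B (Q j w i l)]]] >>.

Definition history n d (Q : nat -> T -> 'M[R]_(n, d)) (k : nat) :=
  sigma_of Q [set j | (j < k)%N].

Definition gaussian_sequence n d (Q : nat -> T -> 'M[R]_(n, d)) : Prop :=
  (forall k, gaussian_matrix (Q k)) /\
  (forall k A B, history Q k A -> sigma_of Q [set k] B ->
     P (A `&` B) = (P A * P B)%E).

(* G k is determined by what was generated up to iteration k included: the
   data x_0, H_0 and the initial matrix being deterministic, the history is
   the one of Q_0, ..., Q_k. *)
Definition determined n d m (Q : nat -> T -> 'M[R]_(n, d))
    (G : nat -> T -> 'M[R]_m) : Prop :=
  forall k i j (B : set R), measurable B ->
    history Q k.+1 [set w | B (G k w i j)].

End gaussian.

Definition gaussian_constants (R : realType) (n d : nat) (C0 C : R) : Prop :=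
  forall (disp : measure_display) (T : measurableType disp)
         (P : probability T R) (Q : T -> 'M[R]_(n, d)),
  gaussian_matrix P Q ->
  (forall (eps : R) (x : 'cV[R]_n), 0 < eps < 1 ->
     ((1 - 2 * expR (- (C0 * eps ^+ 2 * d%:R)))%:E <=
      P [set w | ((1 - eps) * enorm x ^+ 2
                   <= enorm ((Num.sqrt d%:R)^-1 *: ((Q w)^T *m x)) ^+ 2
                   <= (1 + eps) * enorm x ^+ 2)%R])%E) /\
  ((1 - 2 * expR (- d%:R))%:E <=
   P [set w | (d%:R^-1 * opnorm (Q w *m (Q w)^T) <= C * (n%:R / d%:R))%R])%E.

Section algorithm.
Context {R : realType}.

(* The first two columns of A are dropped, u and v are appended at the end
   (meant for m >= 2). *)
Definition push_cols n m (A : 'M[R]_(n, m)) (u v : 'cV[R]_n) : 'M[R]_(n, m) :=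
  \matrix_(i, j) (if (insub j.+2 : option 'I_m) is Some j' then A i j'
                  else if j.+2 == m then u i 0 else v i 0).

Definition armijo n m (f : 'cV[R]_n -> R) (c h : R) (A : 'M[R]_(n, m))
    (x : 'cV[R]_n) (dir : 'cV[R]_m) (a : R) : bool :=
  f (x + a *: (A *m dir)) <= f x + c * a * dotv (fd_grad h f A x) dir.

(* In particular, the line search terminates. *)
Definition line_search n m (f : 'cV[R]_n -> R) (beta c h : R)
    (A : 'M[R]_(n, m)) (x : 'cV[R]_n) (dir : 'cV[R]_m) (a : R) : Prop :=
  exists i : nat, [/\ a = beta ^+ i, armijo f c h A x dir (beta ^+ i) &
    forall j, (j < i)%N -> ~~ armijo f c h A x dir (beta ^+ j)].

Definition bfgs m (s y : 'cV[R]_m) (H : 'M[R]_m) : 'M[R]_m :=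
  (1%:M - (dotv s y)^-1 *: (s *m y^T)) *m H *m
  (1%:M - (dotv s y)^-1 *: (y *m s^T)) + (dotv s y)^-1 *: (s *m s^T).

Definition fd_dir n m (f : 'cV[R]_n -> R) (h : R) (A : 'M[R]_(n, m))
    (H : 'M[R]_m) (x : 'cV[R]_n) : 'cV[R]_m := - (H *m fd_grad h f A x).

(* One run of the algorithm, for given samples Q k; h k is the precision used
   at iteration k, and G k is the matrix chosen for H_{k+1} when s^T y = 0. *)
Record fd_run n m d (f : 'cV[R]_n -> R) (beta c M1 M2 : R) (h : nat -> R)
    (x0 : 'cV[R]_n) (H0 : 'M[R]_m) (Pinit : 'M[R]_(n, m))
    (Q : nat -> 'M[R]_(n, d)) (G : nat -> 'M[R]_m)
    (x : nat -> 'cV[R]_n) (A : nat -> 'M[R]_(n, m)) (H : nat -> 'M[R]_m)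
    (alpha : nat -> R) : Prop := FdRun {
  run_x0 : x 0%N = x0 ;
  run_H0 : H 0%N = H0 ;
  run_A : forall k,
    A k = push_cols (if k is k'.+1 then A k' else Pinit)
            (normalize (x k))
            (normalize (Q k *m fd_grad (h k) f (Q k) (x k))) ;
  run_alpha : forall k,
    line_search f beta c (h k) (A k) (x k)
      (fd_dir f (h k) (A k) (H k) (x k)) (alpha k) ;
  run_x : forall k,
    x k.+1 = x k + alpha k *: (A k *m fd_dir f (h k) (A k) (H k) (x k)) ;
  run_H : forall k,
    let s := alpha k *: fd_dir f (h k) (A k) (H k) (x k) in
    let y := fd_grad (h k) f (A k) (x k.+1) - fd_grad (h k) f (A k) (x k) in
    if dotv s y == 0 then H k.+1 = G k
    else eig_clip M1 M2 (bfgs s y (H k)) (H k.+1)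
}.

Definition fd_iterates disp (T : measurableType disp) (P : probability T R)
    n m d (f : 'cV[R]_n -> R) (beta c M1 M2 : R) (h : nat -> R)
    (x0 : 'cV[R]_n) (H0 : 'M[R]_m) (Pinit : 'M[R]_(n, m))
    (x : nat -> T -> 'cV[R]_n) : Prop :=
  exists (Q : nat -> T -> 'M[R]_(n, d)) (G : nat -> T -> 'M[R]_m)
         (A : nat -> T -> 'M[R]_(n, m)) (H : nat -> T -> 'M[R]_m)
         (alpha : nat -> T -> R),
    [/\ gaussian_sequence P Q,
        determined Q G,
        forall k w, spectral_bounds M1 M2 (G k w) &
        forall w, fd_run f beta c M1 M2 h x0 H0 Pinit (Q^~ w) (G^~ w)
                    (x^~ w) (A^~ w) (H^~ w) (alpha^~ w)].

End algorithm.

Section constants.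
Context {R : realType}.

Definition good_prob (d : nat) (C0 eps : R) : R :=
  1 - (2 * expR (- (C0 * eps ^+ 2 * d%:R)) + 2 * expR (- d%:R)).

Definition Kconst (n m d : nat) (C M1 M2 c L eps : R) : R :=
  Num.max (4 * Num.sqrt d%:R * C * n%:R / (1 - eps))
          (6 * C * n%:R * m%:R ^+ 2 / d%:R * (M2 / (M1 * c) + 1)) * L.

Definition alpha_bar (m : nat) (beta c M2 L : R) : R :=
  Num.min 1 (2 * beta * (1 - 2 * c) / (m%:R * M2 * L)).

Definition descent_const (n m d : nat) (C0 C M1 M2 beta c L eps : R) : R :=
  c * alpha_bar m beta c M2 L * M1 * good_prob d C0 eps / 4 *
  ((1 - eps) * d%:R / (3 * C * n%:R)) ^+ 2.

(* min over 0 <= j <= k; starting the iterated minimum from the term j = 0 does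
   not change it. *)
Definition min_grad n (f : 'cV[R]_n -> R) (x : nat -> 'cV[R]_n) (k : nat) : R :=
  \big[Num.min/enorm (grad f (x 0%N))]_(j < k.+1) enorm (grad f (x j)).

End constants.

(* Main.v *)
Require Import Defs.
From HB Require Import structures.
From mathcomp Require Import all_boot all_order all_algebra.
From mathcomp Require Import all_classical all_reals all_analysis.
From mathcomp Require Import measurable_realfun ring lra.

Set Implicit Arguments.
Unset Strict Implicit.
Unset Printing Implicit Defensive.
Import Order.TTheory GRing.Theory Num.Theory.
Import numFieldNormedType.Exports.

Local Open Scope classical_set_scope.
Local Open Scope ring_scope.

(** Write g for the gradient of f at x_k, A for P_k, Q for the sketch Q_k, h for
    the precision, u for the central differences of f along the columns of A,
    delta for 1 - eps and tau for d / (C n).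

    One iteration. As the gradient is L-Lipschitz, u differs from A^T g by at
    most sqrt m L h / 2 (fd_grad_error, fd_grad_error_norm). As soon as u
    dominates this error, - H u is a descent direction of f itself, backtracking
    stops above alpha_bar, and f decreases by at least
    c alpha_bar M1 |u|^2 (run_decrease); in any case f does not increase. The last
    column of A is the normalization of Q q, where q is close to Q^T g. Hence, if
    |Q^T g|^2 >= th d |g|^2 and the norm of Q Q^T is at most C n, the vector
    A^T g has norm at least of the order of sqrt (th tau) |g| (normalize_align).
    When |g| > K h this beats the discretization error, and f decreases by at least
    c alpha_bar M1 th tau |g|^2 / 4 (run_gain).

    The threshold th. With th = delta, properties (i) and (ii) give the two
    conditions with probability p. But the second entry of K carries no factor
    1 / delta, and when delta is much smaller than tau the error is not
    dominated with this choice. Then th = tau / 696 is taken instead. The entries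
    of Q^T g are Gaussian with deviation |g|, by rotation invariance
    (normal_rotation, normal_combination), so the bound on the Gaussian density
    makes |Q^T g| small only with small probability (sketch_lower). This forces
    tau <= 16 and gives the two conditions with a probability of at least 45/1000,
    whatever eps. Since the rate only asks for a multiple of p delta^2, this is
    enough (good_set_prob).

    Expectations. The iterate x_k is a measurable function of the first k sketches
    (run_measurable); the only delicate step is the spectral clipping, which is
    nonexpansive (eig_clip_lipschitz) and therefore has a continuous extension.
    As Q_k is independent of the past, the probability bound for a fixed
    vector holds conditionally (indep_fubini, fresh_sketch). So the expected
    decrease of f at iteration k is at least a multiple of the expected
    |g|^2 - K^2 h^2 (expected_decrease). Telescoping bounds the average of the
    squared gradients, hence the square of the smallest one, and an inequality of
    arithmetic and geometric means passes to its first moment (mean_min_grad). *)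

(** * The Euclidean norm *)

Section euclidean_theory.
Context {R : realType}.

Lemma dotv_mxE n (u v : 'cV[R]_n) : dotv u v = (u^T *m v) 0 0.
Proof. by rewrite /dotv mxE; apply: eq_bigr => i _; rewrite mxE. Qed.

Lemma dotvC n (u v : 'cV[R]_n) : dotv u v = dotv v u.
Proof. by apply: eq_bigr => i _; rewrite mulrC. Qed.

Lemma dotvDl n (u v w : 'cV[R]_n) : dotv (u + v) w = dotv u w + dotv v w.
Proof. by rewrite -big_split/=; apply: eq_bigr => i _; rewrite mxE mulrDl. Qed.

Lemma dotvDr n (u v w : 'cV[R]_n) : dotv w (u + v) = dotv w u + dotv w v.
Proof. by rewrite dotvC dotvDl !(dotvC w). Qed.

Lemma dotvZl n a (u v : 'cV[R]_n) : dotv (a *: u) v = a * dotv u v.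
Proof. by rewrite /dotv mulr_sumr; apply: eq_bigr => i _; rewrite mxE mulrA. Qed.

Lemma dotvZr n a (u v : 'cV[R]_n) : dotv v (a *: u) = a * dotv v u.
Proof. by rewrite dotvC dotvZl dotvC. Qed.

Lemma dotvNl n (u v : 'cV[R]_n) : dotv (- u) v = - dotv u v.
Proof. by rewrite -scaleN1r dotvZl mulN1r. Qed.

Lemma dotvNr n (u v : 'cV[R]_n) : dotv v (- u) = - dotv v u.
Proof. by rewrite dotvC dotvNl dotvC. Qed.

Lemma dot0v n (u : 'cV[R]_n) : dotv 0 u = 0.
Proof. by rewrite -(scale0r u) dotvZl mul0r. Qed.

Lemma dotvv_ge0 n (u : 'cV[R]_n) : 0 <= dotv u u.
Proof. by apply: sumr_ge0 => i _; rewrite -expr2 sqr_ge0. Qed.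

Lemma dotv_mull n r (A : 'M[R]_(n, r)) u v :
  dotv (A *m u) v = dotv u (A^T *m v).
Proof. by rewrite !dotv_mxE trmx_mul mulmxA. Qed.

Lemma enorm_ge0 n (u : 'cV[R]_n) : 0 <= enorm u.
Proof. exact: sqrtr_ge0. Qed.

Lemma sqr_enorm n (u : 'cV[R]_n) : enorm u ^+ 2 = dotv u u.
Proof. by rewrite sqr_sqrtr// dotvv_ge0. Qed.

Lemma enorm0 n : enorm (0 : 'cV[R]_n) = 0.
Proof. by rewrite /enorm dot0v sqrtr0. Qed.

Lemma enorm_eq0 n (u : 'cV[R]_n) : (enorm u == 0) = (u == 0).
Proof.
apply/idP/idP => [/eqP u0|/eqP ->]; last by rewrite enorm0.
have : dotv u u = 0 by rewrite -sqr_enorm u0 expr0n.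
move/eqP; rewrite psumr_eq0; last by move=> i _; rewrite -expr2 sqr_ge0.
move/allP => ui0; apply/eqP/colP => i; rewrite mxE.
by have /(_ (mem_index_enum i)) := ui0 i; rewrite -expr2 sqrf_eq0 => /eqP.
Qed.

Lemma enormZ n a (u : 'cV[R]_n) : enorm (a *: u) = `|a| * enorm u.
Proof.
by rewrite /enorm dotvZl dotvZr mulrA -expr2 sqrtrM ?sqr_ge0// sqrtr_sqr.
Qed.

Lemma enormN n (u : 'cV[R]_n) : enorm (- u) = enorm u.
Proof. by rewrite -scaleN1r enormZ normrN1 mul1r. Qed.

Lemma cauchy_schwarz n (u v : 'cV[R]_n) : dotv u v <= enorm u * enorm v.
Proof.
have [/eqP|u0] := eqVneq (enorm u) 0.
  by rewrite enorm_eq0 => /eqP ->; rewrite dot0v enorm0 mul0r.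
have [/eqP|v0] := eqVneq (enorm v) 0.
  by rewrite enorm_eq0 => /eqP ->; rewrite dotvC dot0v enorm0 mulr0.
have up : 0 < enorm u by rewrite lt0r u0 enorm_ge0.
have vp : 0 < enorm v by rewrite lt0r v0 enorm_ge0.
have := dotvv_ge0 (enorm v *: u - enorm u *: v).
rewrite dotvDl !dotvDr !dotvNl !dotvNr !dotvZl !dotvZr -!sqr_enorm (dotvC v u).
move=> h; have {}h : 0 <= (enorm u * enorm v) * (enorm u * enorm v - dotv u v).
  by nra.
by move: h; rewrite pmulr_rge0 ?mulr_gt0// subr_ge0.
Qed.

Lemma norm_dotv_le n (u v : 'cV[R]_n) : `|dotv u v| <= enorm u * enorm v.
Proof.
rewrite ler_norml cauchy_schwarz andbT lerNl -dotvNl -(enormN u).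
exact: cauchy_schwarz.
Qed.

Lemma enormD n (u v : 'cV[R]_n) : enorm (u + v) <= enorm u + enorm v.
Proof.
rewrite -(@ler_pXn2r _ 2) ?nnegrE ?addr_ge0 ?enorm_ge0//.
rewrite sqr_enorm dotvDl !dotvDr -!sqr_enorm (dotvC v u).
by have := cauchy_schwarz u v; nra.
Qed.

Lemma enormB_ge n (u v : 'cV[R]_n) : enorm u - enorm (u - v) <= enorm v.
Proof. by rewrite lerBlDr (le_trans _ (enormD _ _))// addrC subrK. Qed.

Lemma coord_le_enorm n (u : 'cV[R]_n) i : `|u i 0| <= enorm u.
Proof.
rewrite -sqrtr_sqr ler_wsqrtr// /dotv (bigD1 i)//= -expr2 lerDl.
by apply: sumr_ge0 => j _; rewrite -expr2 sqr_ge0.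
Qed.

Lemma enorm_le_coord n (u : 'cV[R]_n) a : 0 <= a ->
  (forall i, `|u i 0| <= a) -> enorm u <= Num.sqrt n%:R * a.
Proof.
move=> a0 ua; rewrite -[leRHS]ger0_norm ?mulr_ge0// -sqrtr_sqr ler_wsqrtr//
  exprMn sqr_sqrtr//.
rewrite mulr_natl -[X in _ *+ X](card_ord n) -sumr_const ler_sum// => i _.
by rewrite -expr2 -real_normK ?num_real// ler_pXn2r ?nnegrE.
Qed.

(** With r columns in the unit ball, A v is at most the l1 norm of v, which the
    Cauchy-Schwarz inequality against the all-one vector bounds by sqrt r |v|. *)
Lemma enorm_mul_le n r (A : 'M[R]_(n, r)) (v : 'cV[R]_r) :
  (forall j, enorm (col j A) <= 1) ->
  enorm (A *m v) ^+ 2 <= r%:R * enorm v ^+ 2.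
Proof.
move=> A1.
have ler_sum_norm : enorm (A *m v) <= \sum_j `|v j 0|.
  have -> : A *m v = \sum_j v j 0 *: col j A.
    apply/colP => i; rewrite mxE summxE; apply: eq_bigr => j _.
    by rewrite !mxE mulrC.
  apply: (big_ind2 (fun (x : 'cV_n) y => enorm x <= y)).
  - by rewrite enorm0.
  - by move=> x a y b xa yb; rewrite (le_trans (enormD _ _))// lerD.
  - by move=> j _; rewrite enormZ ler_piMr.
have : (\sum_j `|v j 0|) ^+ 2 <= r%:R * enorm v ^+ 2.
  pose one : 'cV[R]_r := const_mx 1; pose w : 'cV[R]_r := \col_j `|v j 0|.
  have -> : \sum_j `|v j 0| = dotv one w.
    by apply: eq_bigr => j _; rewrite !mxE mul1r.
  have w_ge0 : 0 <= dotv one w by apply: sumr_ge0 => j _; rewrite !mxE mul1r.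
  have -> : r%:R = enorm one ^+ 2.
    rewrite sqr_enorm /dotv (eq_bigr (fun=> 1)) ?sumr_const ?card_ord//.
    by move=> j _; rewrite mxE mul1r.
  have -> : enorm v ^+ 2 = enorm w ^+ 2.
    rewrite !sqr_enorm; apply: eq_bigr => j _.
    by rewrite !mxE -!expr2 real_normK ?num_real.
  by rewrite -exprMn ler_pXn2r ?nnegrE ?mulr_ge0 ?enorm_ge0// cauchy_schwarz.
apply: le_trans; rewrite ler_pXn2r ?nnegrE ?enorm_ge0//.
by apply: sumr_ge0 => j _.
Qed.

End euclidean_theory.

(** * Matrices with bounded spectrum and spectral clipping *)

Section spectral.
Context {R : realType}.

Lemma spectral_lower n (M1 M2 : R) (H : 'M[R]_n) (u : 'cV[R]_n) :
  spectral_bounds M1 M2 H -> M1 * enorm u ^+ 2 <= dotv u (H *m u).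
Proof.
case=> _ [_ /(_ u)] + _.
by rewrite mulmxBl dotvDr dotvNr mul_scalar_mx dotvZr sqr_enorm subr_ge0.
Qed.

(** Positivity of the form of H at the vector u - H u / M2 gives this inequality
    once the quadratic term is bounded by M2 |H u|^2. *)
Lemma spectral_sqr n (M1 M2 : R) (H : 'M[R]_n) (u : 'cV[R]_n) :
  0 < M1 -> M1 <= M2 -> spectral_bounds M1 M2 H ->
  enorm (H *m u) ^+ 2 <= M2 * dotv u (H *m u).
Proof.
move=> M1_gt0 M12 HM; have M2_gt0 := lt_le_trans M1_gt0 M12.
have /(_ (u - M2^-1 *: (H *m u))) low := spectral_lower _ HM.
have upp : dotv (H *m u) (H *m (H *m u)) <= M2 * enorm (H *m u) ^+ 2.
  case: HM => _ _ [_ /(_ (H *m u))].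
  by rewrite mulmxBl dotvDr dotvNr mul_scalar_mx dotvZr sqr_enorm subr_ge0.
have sym : dotv (H *m u) (H *m u) = dotv u (H *m (H *m u)).
  by case: HM => HT _ _; rewrite dotv_mull HT.
have {low} : 0 <= dotv (u - M2^-1 *: (H *m u)) (H *m (u - M2^-1 *: (H *m u))).
  by rewrite (le_trans _ low)// mulr_ge0 ?sqr_ge0// ltW.
rewrite mulmxBr -scalemxAr !dotvDl !dotvDr !dotvNl !dotvNr !dotvZl !dotvZr -sym.
rewrite -!sqr_enorm.
set a := dotv u _; set b := dotv _ _ in upp *; set e := enorm _ ^+ 2 in upp *.
move=> h; have MV : M2 * M2^-1 = 1 by rewrite mulfV ?gt_eqF.
have : 0 <= M2 ^+ 2 * (a - M2^-1 * e + - (M2^-1 * e - M2^-1 * (M2^-1 * b))).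
  by rewrite mulr_ge0 ?sqr_ge0//; move: h; congr (0 <= _); ring.
have -> : M2 ^+ 2 * (a - M2^-1 * e + - (M2^-1 * e - M2^-1 * (M2^-1 * b))) =
  M2 ^+ 2 * a - M2 * e *+ 2 + b by field; rewrite gt_eqF.
move=> {}h; have {h} : 0 <= M2 * (M2 * a - e) by nra.
by rewrite pmulr_rge0// subr_ge0.
Qed.

Lemma eig_clip_bounds n (M1 M2 : R) (A B : 'M[R]_n) :
  M1 <= M2 -> eig_clip M1 M2 A B -> spectral_bounds M1 M2 B.
Proof.
move=> M12 [U [lam [UU _ ->]]]; set D := map_mx _ lam.
have UUt : U *m U^T = 1%:M by rewrite mulmx1C.
have symB (E : 'rV[R]_n) : (U *m diag_mx E *m U^T)^T = U *m diag_mx E *m U^T.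
  by rewrite !trmx_mul trmxK tr_diag_mx mulmxA.
have psdD (E : 'rV[R]_n) : (forall i, 0 <= E 0 i) ->
    psd (U *m diag_mx E *m U^T).
  move=> E0; split=> // v; rewrite -!mulmxA -{1}(trmxK U) -dotv_mull.
  move: (U^T *m v) => w.
  apply: sumr_ge0 => i _; rewrite mul_diag_mx mxE mulrCA -expr2.
  by rewrite mulr_ge0 ?sqr_ge0.
have scalE (a : R) : a%:M = U *m diag_mx (const_mx a) *m U^T.
  by rewrite diag_const_mx mul_mx_scalar -scalemxAl UUt scalemx1.
split; first exact: symB.
- rewrite /loewner_le (scalE M1) -mulmxBl -mulmxBr -raddfB.
  apply: psdD => i; rewrite !mxE subr_ge0 le_max.
  by rewrite lexx.
- rewrite /loewner_le (scalE M2) -mulmxBl -mulmxBr -raddfB.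
  apply: psdD => i; rewrite !mxE subr_ge0 ge_max M12.
  by rewrite ge_min lexx.
Qed.

Let sqF n (X : 'M[R]_n) := \sum_i \sum_j X i j ^+ 2.

Let sqF_tr n (X : 'M[R]_n) : sqF X = \tr (X *m X^T).
Proof.
rewrite /sqF /mxtrace; apply: eq_bigr => i _; rewrite mxE.
by apply: eq_bigr => j _; rewrite mxE expr2.
Qed.

Let sqF_orth n (U V X : 'M[R]_n) : U^T *m U = 1%:M -> V^T *m V = 1%:M ->
  sqF (U^T *m X *m V) = sqF X.
Proof.
move=> /mulmx1C UU /mulmx1C VV; rewrite !sqF_tr !trmx_mul trmxK -!mulmxA.
rewrite [LHS]mxtrace_mulC !mulmxA.
rewrite -[X *m V *m V^T]mulmxA VV mulmx1.
by rewrite -[X *m X^T *m U *m U^T]mulmxA UU mulmx1.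
Qed.

Let sqF_diff n (U V : 'M[R]_n) (l l' : 'rV[R]_n) :
  U^T *m U = 1%:M -> V^T *m V = 1%:M ->
  sqF (U *m diag_mx l *m U^T - V *m diag_mx l' *m V^T) =
  \sum_i \sum_j ((l 0 i - l' 0 j) * (U^T *m V) i j) ^+ 2.
Proof.
move=> UU VV; rewrite -(sqF_orth _ UU VV); apply: eq_bigr => i _.
apply: eq_bigr => j _; congr (_ ^+ 2).
rewrite mulmxBr mulmxBl !mulmxA UU mul1mx -!mulmxA VV mulmx1.
rewrite [U^T *m (V *m _)]mulmxA; move: (U^T *m V) => W.
by rewrite mul_diag_mx mul_mx_diag !mxE mulrBl (mulrC (l' 0 j)).
Qed.

(** If U diagonalizes A and V diagonalizes A', the squared Frobenius distance
    of A and A' is the sum of (l_i - l'_j)^2 W_ij^2 with W = U^T V. The weights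
    are the same before and after clipping, and clipping real numbers is
    nonexpansive. In particular the clipped matrix does not depend on the
    choice of the eigenvectors. *)
Lemma eig_clip_lipschitz n (M1 M2 : R) (A B A' B' : 'M[R]_n) :
  eig_clip M1 M2 A B -> eig_clip M1 M2 A' B' ->
  \sum_i \sum_j (B - B') i j ^+ 2 <= \sum_i \sum_j (A - A') i j ^+ 2.
Proof.
move=> [U [l [UU -> ->]]] [V [l' [VV -> ->]]].
rewrite -![X in X <= _]/(sqF _) -![X in _ <= X]/(sqF _) !sqF_diff//.
apply: ler_sum => i _; apply: ler_sum => j _.
rewrite !exprMn ler_wpM2r ?sqr_ge0// !mxE.
rewrite -(real_normK (num_real (_ - _))) -[leRHS](real_normK (num_real _)).
rewrite ler_pXn2r ?nnegrE//.
move: (l 0 i) (l' 0 j) => a b.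
have lip_max (s x y : R) : `|Num.max s x - Num.max s y| <= `|x - y|.
  have := ler_norm (x - y); have := ler_norm (y - x).
  rewrite (distrC y) ler_norml => ? ?; apply/andP.
  by case: (leP s x) => ?; case: (leP s y) => ?; lra.
have lip_min (s x y : R) : `|Num.min s x - Num.min s y| <= `|x - y|.
  have := ler_norm (x - y); have := ler_norm (y - x).
  rewrite (distrC y) ler_norml => ? ?; apply/andP.
  by case: (leP s x) => ?; case: (leP s y) => ?; lra.
exact: le_trans (lip_max _ _ _) (lip_min _ _ _).
Qed.

End spectral.

(** * Taylor bounds and central differences *)

Section smooth_theory.
Context {R : realType} (n : nat) (f : 'cV[R]_n -> R).
Hypothesis f_diff : forall x, differentiable (f : 'cV[R]_n -> R^o) x.

Lemma derive_dotv_grad (x v : 'cV[R]_n) :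
  'D_v (f : 'cV[R]_n -> R^o) x = dotv (grad f x) v.
Proof.
rewrite deriveE//; have {1}-> : v = \sum_i v i 0 *: basis_vec i.
  apply/colP => i; rewrite summxE (bigD1 i)//= !mxE !eqxx mulr1.
  rewrite big1 ?addr0// => j ji.
  by rewrite !mxE eq_sym (negbTE ji) mulr0.
rewrite linear_sum; apply: eq_bigr => i _.
by rewrite linearZ/= mxE /partial deriveE// mulrC.
Qed.

Lemma is_derive_along (x v : 'cV[R]_n) (t : R) :
  is_derive t 1 (fun t : R => f (x + t *: v) : R^o)
    (dotv (grad f (x + t *: v)) v).
Proof.
have eqF : (fun h : R => h^-1 *: ((fun t : R => f (x + t *: v) : R^o) (h *: 1 + t)
              - f (x + t *: v) : R^o)) =
    (fun h : R => h^-1 *: ((f : _ -> R^o) (h *: v + (x + t *: v))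
              - f (x + t *: v) : R^o)).
  by apply/funext => h; congr (_ *: (f _ - _)); rewrite addrCA -scalerDl [h *: 1]mulr1.
have dv : derivable (f : _ -> R^o) (x + t *: v) v by exact: diff_derivable.
apply: DeriveDef; first by rewrite /derivable /= eqF.
by rewrite -derive_dotv_grad /derive /= eqF.
Qed.

Variable L : R.
Hypothesis grad_lip : forall u v : 'cV[R]_n,
  enorm (grad f u - grad f v) <= L * enorm (u - v).

(** The factor 1/2 comes from the mean value theorem applied to the remainder
    minus its quadratic bound, whose derivative along the segment is
    nonpositive; the sign s covers the upper and the lower bound at once. *)
Let taylor_sgn (s : R) (x v : 'cV[R]_n) : `|s| = 1 ->
  s * (f (x + v) - f x - dotv (grad f x) v) <= L / 2 * enorm v ^+ 2.
Proof.
move=> s1.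
pose psi (t : R) : R^o := s * (f (x + t *: v) - t * dotv (grad f x) v)
  - L / 2 * enorm v ^+ 2 * t ^+ 2.
pose dpsi (t : R) : R := s * (dotv (grad f (x + t *: v)) v - dotv (grad f x) v)
  - L / 2 * enorm v ^+ 2 * (t *+ 2).
have dP (t : R) : is_derive t 1 psi (dpsi t).
  have ? := is_derive_along x v t.
  apply: is_derive_eq; rewrite /dpsi scaler0 add0r /GRing.scale/= !mulr1.
  by rewrite mulr2n.
have [c c01] : exists2 c, c \in `[0, 1]%R & psi 1 - psi 0 = dpsi c * (1 - 0).
  apply: MVT_segment => //; apply: continuous_subspaceT => t.
  by apply: differentiable_continuous; apply/derivable1_diffP.
rewrite /psi /dpsi scale1r scale0r addr0 subr0 mulr1 => E.
suff : s * (f (x + v) - dotv (grad f x) v - f x) - L / 2 * enorm v ^+ 2 <= 0.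
  by rewrite subr_le0 addrAC.
have -> : s * (f (x + v) - dotv (grad f x) v - f x) - L / 2 * enorm v ^+ 2 =
  psi 1 - psi 0 by rewrite /psi scale1r scale0r addr0; ring.
rewrite /psi scale1r scale0r addr0 E subr_le0.
move: c01; rewrite in_itv/= => /andP[c0 _].
rewrite -dotvNl -dotvDl.
apply: le_trans (ler_norm _) _; rewrite normrM s1 mul1r.
apply: le_trans (norm_dotv_le _ _) _.
apply: le_trans (ler_wpM2r (enorm_ge0 _) (grad_lip _ _)) _.
rewrite addrAC subrr add0r enormZ ger0_norm// -mulr_natr.
by rewrite le_eqVlt; apply/orP; left; apply/eqP; field.
Qed.

Lemma taylor_grad (x v : 'cV[R]_n) :
  `|f (x + v) - f x - dotv (grad f x) v| <= L / 2 * enorm v ^+ 2.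
Proof.
rewrite ler_norml lerNl -mulN1r taylor_sgn ?normrN1// -[leLHS]mul1r.
by rewrite taylor_sgn ?normr1.
Qed.

(** The first order terms at x + h v and x - h v add up, so only the two Taylor
    remainders, each at most L h^2 |v|^2 / 2, are divided by 2 h. *)
Lemma fd_grad_error (h : R) r (A : 'M[R]_(n, r)) x i : 0 < h ->
  `|fd_grad h f A x i 0 - (A^T *m grad f x) i 0|
    <= L * h / 2 * enorm (col i A) ^+ 2.
Proof.
move=> h0; rewrite mxE; set v := col i A.
have -> : (A^T *m grad f x) i 0 = dotv (grad f x) v.
  by rewrite mxE; apply: eq_bigr => j _; rewrite !mxE mulrC.
have := taylor_grad x (h *: v); have := taylor_grad x (- (h *: v)).
rewrite enormN enormZ (gtr0_norm h0) exprMn dotvNr dotvZr.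
set a := f (x - _); set b := f (x + h *: v); set g := dotv _ _; set e := enorm _ ^+ 2.
move=> h1 h2; have E (u : R) : u = (2 * h)^-1 * (2 * h * u).
  by rewrite mulKf// gt_eqF// mulr_gt0.
rewrite [X in `|X|]E normrM gtr0_norm ?invr_gt0 ?mulr_gt0//.
rewrite [leRHS]E ler_pM2l ?invr_gt0 ?mulr_gt0//.
rewrite [X in `|X|](_ : _ = (b - f x - h * g) - (a - f x - (- (h * g)))); last first.
  by field; rewrite gt_eqF.
apply: le_trans (ler_normB _ _) _; apply: le_trans (lerD h2 h1) _.
by rewrite le_eqVlt; apply/orP; left; apply/eqP; field.
Qed.

End smooth_theory.

(** * One iteration: sufficient decrease *)

Section one_iteration.
Context {R : realType} (n m : nat) (f : 'cV[R]_n -> R).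
Hypothesis f_diff : forall x, differentiable (f : 'cV[R]_n -> R^o) x.
Variable L : R.
Hypothesis L_gt0 : 0 < L.
Hypothesis grad_lip : forall u v : 'cV[R]_n,
  enorm (grad f u - grad f v) <= L * enorm (u - v).
Hypothesis m_gt0 : (0 < m)%N.
Variables beta c M1 M2 : R.
Hypothesis beta01 : 0 < beta < 1.
Hypothesis c_gt0 : 0 < c.
Hypothesis c_lt_half : c < 1 / 2.
Hypothesis M1_gt0 : 0 < M1.
Hypothesis M1_le_M2 : M1 <= M2.
Variables (h : R) (A : 'M[R]_(n, m)) (H : 'M[R]_m) (x x' : 'cV[R]_n) (a : R).
Hypothesis h_gt0 : 0 < h.
Hypothesis A1 : forall j, enorm (col j A) <= 1.
Hypothesis HM : spectral_bounds M1 M2 H.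
Hypothesis ls : line_search f beta c h A x (fd_dir f h A H x) a.
Hypothesis x'E : x' = x + a *: (A *m fd_dir f h A H x).

Let u := fd_grad h f A x.
Let q := dotv u (H *m u).

Let q_lower : M1 * enorm u ^+ 2 <= q.
Proof. exact: (spectral_lower _ HM). Qed.

Let q_ge0 : 0 <= q.
Proof. by rewrite (le_trans _ q_lower)// mulr_ge0 ?sqr_ge0// ltW. Qed.

Let dir_dot : dotv u (fd_dir f h A H x) = - q.
Proof. exact: dotvNr. Qed.

Let a_gt0 : 0 < a.
Proof. by have [i [-> _ _]] := ls; case/andP: beta01 => *; rewrite exprn_gt0. Qed.

Let armijo_decrease : c * a * q <= f x - f x'.
Proof.
have [i [aE + _]] := ls; rewrite /armijo -aE -x'E -/u dir_dot.
by rewrite mulrN; lra.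
Qed.

Lemma run_descent : f x' <= f x.
Proof.
rewrite -subr_ge0 (le_trans _ armijo_decrease)//.
by rewrite !mulr_ge0// ltW.
Qed.

Lemma fd_grad_error_norm :
  enorm (u - A^T *m grad f x) <= Num.sqrt m%:R * (L * h / 2).
Proof.
have Lh : 0 <= L * h / 2 by rewrite divr_ge0// mulr_ge0// ltW.
apply: enorm_le_coord => // i; rewrite !mxE.
have := fd_grad_error f_diff grad_lip A x i h_gt0; rewrite !mxE => /le_trans; apply.
by rewrite ler_piMr// exprn_ile1// enorm_ge0.
Qed.

(** If a step t = beta ^ i is refused, comparing the failed Armijo test with the
    Taylor upper bound gives t > 2 (1 - 2 c) / (m M2 L): one c is spent on the
    test, the other on the error of the finite differences. The accepted step is
    beta times the last refused one. *)
Let step_lower : M2 * (Num.sqrt m%:R * (L * h / 2)) <= c * M1 * enorm u ->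
  0 < q -> alpha_bar m beta c M2 L <= a.
Proof.
move=> u_large q_gt0; have M2_gt0 := lt_le_trans M1_gt0 M1_le_M2.
case/andP: beta01 => b0 b1; rewrite /alpha_bar.
have [[|i] [-> _]] := ls; first by rewrite expr0 ge_min lexx.
move=> /(_ i (ltnSn i)); rewrite /armijo -ltNge -/u dir_dot.
have : 0 < beta ^+ i by rewrite exprn_gt0.
rewrite exprS; set t := beta ^+ i => t0; set d := fd_dir f h A H x => fail.
have d_sqr : enorm d ^+ 2 <= M2 * q by rewrite /d /fd_dir enormN (spectral_sqr _ M1_gt0).
have d_le : enorm d <= M2 * enorm u.
  have [->|d0] := eqVneq (enorm d) 0; first by rewrite mulr_ge0 ?enorm_ge0// ltW.
  have dp : 0 < enorm d by rewrite lt0r d0 enorm_ge0.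
  rewrite -(ler_pM2l dp) -expr2 (le_trans d_sqr)// mulrCA ler_pM2l//.
  by rewrite mulrC /q (le_trans (cauchy_schwarz _ _))// /d /fd_dir enormN.
have slope : dotv (grad f x) (A *m d) <= - q + c * q.
  have -> : dotv (grad f x) (A *m d) =
      dotv u d - dotv (u - A^T *m grad f x) d.
    by rewrite dotvC dotv_mull (dotvC d) dotvDl dotvNl opprB addrC subrK.
  rewrite dir_dot lerD2l -dotvNl (le_trans (cauchy_schwarz _ _))// enormN.
  apply: le_trans (ler_pM (enorm_ge0 _) (enorm_ge0 _) fd_grad_error_norm d_le) _.
  rewrite mulrA (le_trans (y := c * M1 * enorm u * enorm u))//.
    by rewrite ler_wpM2r ?enorm_ge0// mulrC.
  by rewrite -!mulrA ler_pM2l// -expr2.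
have Ad : enorm (A *m d) ^+ 2 <= m%:R * (M2 * q).
  by rewrite (le_trans (enorm_mul_le _ A1))// ler_wpM2l.
have upper := taylor_grad f_diff grad_lip x (t *: (A *m d)).
have {}upper : f (x + t *: (A *m d)) - f x <= t * (- q + c * q)
    + L / 2 * (t ^+ 2 * (m%:R * (M2 * q))).
  rewrite -lerBlDl (le_trans _ (le_trans (ler_norm _) (le_trans upper _)))//.
    by rewrite dotvZr lerB// ler_pM2l.
  rewrite enormZ exprMn (gtr0_norm t0) !ler_wpM2l ?divr_ge0 ?sqr_ge0//.
  by rewrite ltW.
have mp : 0 < m%:R * M2 * L by rewrite !mulr_gt0// ltr0n.
rewrite ge_min; apply/orP; right.
rewrite -mulrA -mulrA mulrCA mulrA -[leLHS]mulrA ler_pM2l//.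
rewrite mulrA ler_pdivrMr//.
have : 0 < t * q * (m%:R * M2 * L * t - 2 * (1 - 2 * c)).
  by move: fail upper; move: (f (x + _)) => y; nra.
by rewrite pmulr_rgt0 ?mulr_gt0// subr_gt0 [t * _]mulrC => /ltW.
Qed.

(** Once fd_grad dominates its own discretization error, the direction has slope
    at most - (1 - c) q for f itself, so backtracking stops above alpha_bar and
    the Armijo test turns this step into a decrease. *)
Lemma run_decrease : M2 * (Num.sqrt m%:R * (L * h / 2)) <= c * M1 * enorm u ->
  c * alpha_bar m beta c M2 L * M1 * enorm u ^+ 2 <= f x - f x'.
Proof.
move=> u_large; have [u0|u0] := eqVneq (enorm u) 0.
  by rewrite u0 expr0n/= mulr0 subr_ge0 run_descent.
have q_gt0 : 0 < q.
  by rewrite (lt_le_trans _ q_lower)// mulr_gt0// exprn_gt0// lt0r u0 enorm_ge0.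
apply: le_trans armijo_decrease; rewrite -!mulrA ler_pM2l//.
apply: ler_pM q_lower => //.
- rewrite /alpha_bar le_min ler01 divr_ge0//.
    have c2 : 0 <= 1 - 2 * c by rewrite subr_ge0 mulrC -ler_pdivlMr// ltW.
    by case/andP: beta01 => /ltW b0 _; rewrite mulr_ge0// mulr_ge0.
  by rewrite !mulr_ge0// ltW// (lt_le_trans M1_gt0).
- by rewrite mulr_ge0 ?sqr_ge0// ltW.
- exact: step_lower.
Qed.

End one_iteration.

(** * Operator norm and sketched gradients *)

Section operator_norm.
Context {R : realType}.

Lemma enorm_mul_opnorm n r (A : 'M[R]_(n, r)) (v : 'cV[R]_r) :
  enorm (A *m v) <= opnorm A * enorm v.
Proof.
pose E := [set enorm (A *m w) | w in [set w : 'cV[R]_r | enorm w <= 1]].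
have ubE : has_ubound E.
  exists (\sum_j enorm (col j A)) => _ [w /= w1 <-].
  have -> : A *m w = \sum_j w j 0 *: col j A.
    apply/colP => i; rewrite mxE summxE; apply: eq_bigr => j _.
    by rewrite !mxE mulrC.
  apply: (big_ind2 (fun (x : 'cV_n) y => enorm x <= y)).
  - by rewrite enorm0.
  - by move=> x a y b xa yb; rewrite (le_trans (enormD _ _))// lerD.
  - move=> j _; rewrite enormZ ler_piMl ?enorm_ge0//.
    exact: le_trans (coord_le_enorm _ _) w1.
have [v0|v0] := eqVneq (enorm v) 0.
  by have /eqP := v0; rewrite enorm_eq0 => /eqP ->; rewrite mulmx0 !enorm0 mulr0.
have vp : 0 < enorm v by rewrite lt0r v0 enorm_ge0.
rewrite -ler_pdivrMr//; have -> : enorm (A *m v) / enorm v =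
    enorm (A *m ((enorm v)^-1 *: v)).
  by rewrite -scalemxAr enormZ gtr0_norm ?invr_gt0// mulrC.
apply: ub_le_sup => //; exists ((enorm v)^-1 *: v) => //=.
by rewrite enormZ gtr0_norm ?invr_gt0// mulVf.
Qed.

Lemma enorm_trmul_le n r (A : 'M[R]_(n, r)) (B : R) (y : 'cV[R]_n) :
  opnorm (A *m A^T) <= B -> enorm (A^T *m y) ^+ 2 <= B * enorm y ^+ 2.
Proof.
move=> AB; rewrite sqr_enorm dotv_mull trmxK mulmxA expr2 mulrA.
apply: le_trans (cauchy_schwarz _ _) _; rewrite mulrC.
rewrite ler_wpM2r ?enorm_ge0//.
by rewrite (le_trans (enorm_mul_opnorm _ _))// ler_wpM2r ?enorm_ge0.
Qed.

(** A and A^T have the same norm: |A v|^2 is the scalar product of v with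
    A^T (A v), to which the bound on A^T applies. *)
Lemma enorm_mul_sqr_le n r (A : 'M[R]_(n, r)) (B : R) (v : 'cV[R]_r) :
  0 <= B -> opnorm (A *m A^T) <= B -> enorm (A *m v) ^+ 2 <= B * enorm v ^+ 2.
Proof.
move=> B0 AB; have [->|w0] := eqVneq (enorm (A *m v)) 0.
  by rewrite expr0n/= mulr_ge0 ?sqr_ge0.
have wp : 0 < enorm (A *m v) ^+ 2 by rewrite exprn_gt0// lt0r w0 enorm_ge0.
rewrite -(ler_pM2l wp) -expr2.
have cs : enorm (A *m v) ^+ 2 <= enorm v * enorm (A^T *m (A *m v)).
  by rewrite {1}sqr_enorm dotv_mull cauchy_schwarz.
apply: (@le_trans _ _ ((enorm v * enorm (A^T *m (A *m v))) ^+ 2)).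
  by rewrite ler_pXn2r ?nnegrE ?sqr_ge0 ?mulr_ge0 ?enorm_ge0.
rewrite exprMn [leRHS]mulrA [leRHS]mulrC.
by rewrite ler_wpM2l ?sqr_ge0// mulrC enorm_trmul_le.
Qed.

Lemma normalize_le1 n (u : 'cV[R]_n) : enorm (normalize u) <= 1.
Proof.
rewrite /normalize enormZ normfV ger0_norm ?enorm_ge0//.
by have [->|u0] := eqVneq (enorm u) 0; rewrite ?mulr0// mulVf.
Qed.

(** For v = Q^T g the cosine is |Q^T g|^2 / |Q Q^T g|, at least |Q^T g| / sqrt B.
    A relative error of 1/8 on v costs the factor 7/8 in the numerator and 9/8
    in the denominator. *)
Lemma normalize_align n r (Q : 'M[R]_(n, r)) (g : 'cV[R]_n) (v : 'cV[R]_r) B :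
  0 < B -> opnorm (Q *m Q^T) <= B -> 0 < enorm (Q^T *m g) ->
  enorm (v - Q^T *m g) <= enorm (Q^T *m g) / 8 ->
  (7 / 9) ^+ 2 * enorm (Q^T *m g) ^+ 2 / B <= dotv (normalize (Q *m v)) g ^+ 2
  /\ 0 <= dotv (normalize (Q *m v)) g.
Proof.
move=> B0 QB; set z := enorm (Q^T *m g); set e := v - _ => z0 ez.
have vE : v = Q^T *m g + e by rewrite addrC subrK.
have num : 7 / 8 * z ^+ 2 <= dotv (Q *m v) g.
  rewrite dotv_mull {1}vE dotvDl -sqr_enorm -/z.
  have := norm_dotv_le e (Q^T *m g); rewrite -/z ler_norml => /andP[+ _].
  by have : enorm e * z <= z / 8 * z by [rewrite ler_wpM2r ?(ltW z0)]; nra.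
have z2 : 0 < z ^+ 2 by rewrite exprn_gt0.
have num0 : 0 < dotv (Q *m v) g by apply: lt_le_trans num; rewrite mulr_gt0.
have den : enorm (Q *m v) ^+ 2 <= B * (9 / 8 * z) ^+ 2.
  rewrite (le_trans (enorm_mul_sqr_le _ (ltW B0) QB))// ler_pM2l//.
  rewrite ler_pXn2r ?nnegrE ?enorm_ge0 ?mulr_ge0 ?(ltW z0)//.
  rewrite {1}vE (le_trans (enormD _ _))// -/z.
  by have : z + enorm e <= z + z / 8 by [rewrite lerD2l]; lra.
have w0 : 0 < enorm (Q *m v).
  rewrite lt0r enorm_ge0 andbT enorm_eq0; apply: contraL num0 => /eqP ->.
  by rewrite dot0v ltxx.
rewrite /normalize dotvZl; split; last by rewrite mulr_ge0 ?invr_ge0 ?ltW.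
rewrite [leRHS]exprMn exprVn [leRHS]mulrC ler_pdivlMr ?exprn_gt0// mulrAC ler_pdivrMr//.
apply: (@le_trans _ _ ((7 / 8 * z ^+ 2) ^+ 2 * B)); last first.
  by rewrite ler_pM2r// ler_pXn2r// nnegrE ?(ltW num0)// mulr_ge0 ?divr_ge0 ?(ltW z2).
apply: (@le_trans _ _ ((B * (9 / 8 * z) ^+ 2) * ((7 / 9) ^+ 2 * z ^+ 2))).
  by rewrite [leLHS]mulrC ler_pM2r// mulr_gt0 ?exprn_gt0// divr_gt0.
by rewrite le_eqVlt; apply/orP; left; apply/eqP; field.
Qed.

End operator_norm.

(** * One iteration: progress on a good sketch *)

Section iteration_gain.
Context {R : realType} (n m d : nat) (f : 'cV[R]_n -> R).
Hypothesis f_diff : forall x, differentiable (f : 'cV[R]_n -> R^o) x.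
Variable L : R.
Hypothesis L_gt0 : 0 < L.
Hypothesis grad_lip : forall u v : 'cV[R]_n,
  enorm (grad f u - grad f v) <= L * enorm (u - v).
Hypothesis d_gt0 : (0 < d)%N.
Hypothesis n_gt0 : (0 < n)%N.
Hypothesis m_ge2 : (1 < m)%N.
Variables beta c M1 M2 C : R.
Hypothesis beta01 : 0 < beta < 1.
Hypothesis c_gt0 : 0 < c.
Hypothesis c_lt_half : c < 1 / 2.
Hypothesis M1_gt0 : 0 < M1.
Hypothesis M1_le_M2 : M1 <= M2.
Hypothesis C_gt0 : 0 < C.
Variables (eps th : R).
Hypothesis eps01 : 0 < eps < 1.
Hypothesis th_eps : 1 - eps <= th.
Hypothesis th_tau : d%:R / (C * n%:R) <= 696 * th.
Variables (h : R) (A : 'M[R]_(n, m)) (H : 'M[R]_m) (x x' : 'cV[R]_n) (a : R).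
Variable Q : 'M[R]_(n, d).
Hypothesis h_gt0 : 0 < h.
Hypothesis A1 : forall j, enorm (col j A) <= 1.
Hypothesis HM : spectral_bounds M1 M2 H.
Hypothesis ls : line_search f beta c h A x (fd_dir f h A H x) a.
Hypothesis x'E : x' = x + a *: (A *m fd_dir f h A H x).
Variable j0 : 'I_m.
Hypothesis Aj0 : col j0 A = normalize (Q *m fd_grad h f Q x).

Let g := grad f x.
Let G := enorm g.
Let B0 := C * n%:R.
Let tau := d%:R / B0.
Let z := enorm (Q^T *m g).
Hypothesis large : Kconst n m d C M1 M2 c L eps * h < G.
Hypothesis good_low : th * d%:R * G ^+ 2 <= z ^+ 2.
Hypothesis good_op : opnorm (Q *m Q^T) <= B0.

Let B0_gt0 : 0 < B0. Proof. by rewrite mulr_gt0// ltr0n. Qed.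
Let d_ge1 : 1 <= d%:R :> R. Proof. by rewrite ler1n. Qed.
Let dp : 0 < d%:R :> R. Proof. by rewrite ltr0n. Qed.
Let del_gt0 : 0 < 1 - eps. Proof. by case/andP: eps01; lra. Qed.
Let th_gt0 : 0 < th. Proof. exact: lt_le_trans th_eps. Qed.

Let K1 := 4 * Num.sqrt d%:R * C * n%:R / (1 - eps).
Let K2 := 6 * C * n%:R * m%:R ^+ 2 / d%:R * (M2 / (M1 * c) + 1).

Let G1 : K1 * L * h < G.
Proof.
apply: le_lt_trans large; rewrite ler_pM2r// ler_pM2r//.
by rewrite le_max lexx.
Qed.

Let G2 : K2 * L * h < G.
Proof.
apply: le_lt_trans large; rewrite ler_pM2r// ler_pM2r//.
by rewrite le_max lexx orbT.
Qed.

Let G_gt0 : 0 < G.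
Proof.
apply: le_lt_trans G1; rewrite /K1 !mulr_ge0 ?invr_ge0 ?sqrtr_ge0//; exact: ltW.
Qed.

Let z_lower : (1 - eps) * G <= z.
Proof.
have G2_ge0 : 0 <= G ^+ 2 by rewrite sqr_ge0.
rewrite -(@ler_pXn2r _ 2) ?nnegrE ?mulr_ge0 ?enorm_ge0 ?(ltW del_gt0)//.
apply: le_trans good_low; rewrite exprMn ler_wpM2r//.
have /andP[e0 e1] := eps01.
apply: (@le_trans _ _ (1 - eps)); first by nra.
by apply: le_trans th_eps _; rewrite ler_peMr// ltW.
Qed.

Let z_gt0 : 0 < z.
Proof. by apply: lt_le_trans z_lower; rewrite mulr_gt0. Qed.

Let col_Q j : enorm (col j Q) ^+ 2 <= B0.
Proof.
rewrite colE (le_trans (enorm_mul_sqr_le _ (ltW B0_gt0) good_op))//.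
rewrite ler_piMr ?(ltW B0_gt0)// sqr_enorm /dotv (bigD1 j)//= big1 ?addr0.
  by rewrite !mxE !eqxx mulr1.
by move=> i ij; rewrite !mxE (negbTE ij) mulr0.
Qed.

Let sketch_error : enorm (fd_grad h f Q x - Q^T *m g) <= z / 8.
Proof.
have LhB : 0 <= L * h / 2 * B0 by rewrite mulr_ge0 ?divr_ge0 ?mulr_ge0// ltW.
apply: (@le_trans _ _ (Num.sqrt d%:R * (L * h / 2 * B0))).
  apply: enorm_le_coord => // i.
  have := fd_grad_error f_diff grad_lip Q x i h_gt0; rewrite -/g.
  rewrite [X in _ -> `|X| <= _]mxE [X in _ -> `|_ + X| <= _]mxE => /le_trans.
  by apply; rewrite ler_wpM2l// divr_ge0// mulr_ge0// ltW.
have : (1 - eps) * (K1 * L * h) <= z.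
  by apply: le_trans z_lower; rewrite ler_pM2l// ltW.
have -> : (1 - eps) * (K1 * L * h) = 8 * (Num.sqrt d%:R * (L * h / 2 * B0)).
  by rewrite /K1 /B0; field; rewrite gt_eqF.
by move=> ?; lra.
Qed.

Let W := enorm (A^T *m g).
Let b := Num.sqrt m%:R * (L * h / 2).
Let kap := M2 / (M1 * c).

Let W_sqr : (7 / 9) ^+ 2 * (th * tau) * G ^+ 2 <= W ^+ 2.
Proof.
have [al al0] := normalize_align B0_gt0 good_op z_gt0 sketch_error.
apply: (@le_trans _ _ ((7 / 9) ^+ 2 * z ^+ 2 / B0)).
  rewrite ler_pdivlMr//.
  have -> : (7 / 9) ^+ 2 * (th * tau) * G ^+ 2 * B0 =
      (7 / 9) ^+ 2 * (th * d%:R * G ^+ 2).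
    by rewrite /tau; field; rewrite gt_eqF.
  by rewrite ler_wpM2l// exprn_ge0// divr_ge0.
apply: le_trans al _; rewrite -Aj0.
have -> : dotv (col j0 A) g = (A^T *m g) j0 0.
  by rewrite mxE; apply: eq_bigr => j _; rewrite !mxE.
rewrite -real_normK ?num_real// ler_pXn2r ?nnegrE ?enorm_ge0//.
exact: coord_le_enorm.
Qed.

Let kap_ge2 : 2 <= kap.
Proof.
rewrite /kap ler_pdivlMr ?mulr_gt0//.
have : M1 * c <= M1 / 2 by rewrite ler_pM2l//; move: c_lt_half; lra.
by move: M1_le_M2; lra.
Qed.

(** Discretization errors are dominated: after squaring, the second entry of
    Kconst leaves the factor (49 * 144 / 81) m^3 th / tau, and m >= 2 together
    with tau <= 696 th makes it at least 1. *)
Let W_large : (kap + 1) * b <= W.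
Proof.
have b0 : 0 <= b by rewrite mulr_ge0 ?sqrtr_ge0 ?divr_ge0 ?mulr_ge0// ltW.
have k0 : 0 <= kap + 1 by have := kap_ge2; lra.
have kb0 : 0 <= (kap + 1) * b by rewrite mulr_ge0.
rewrite -(@ler_pXn2r _ 2) ?nnegrE ?enorm_ge0//.
apply: le_trans W_sqr.
have tau_gt0 : 0 < tau by rewrite divr_gt0.
have K2E : K2 * L * h = 6 / tau * m%:R ^+ 2 * (kap + 1) * L * h.
  rewrite /K2 /tau /B0 -/kap; field.
  by rewrite !gt_eqF// ltr0n.
have K20 : 0 <= K2 * L * h.
  have tau6 : 0 <= 6 / tau by rewrite divr_ge0 ?(ltW tau_gt0).
  rewrite K2E; apply: mulr_ge0; last exact: ltW.
  apply: mulr_ge0; last exact: ltW.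
  by rewrite mulr_ge0// mulr_ge0// sqr_ge0.
have Gsq : (K2 * L * h) ^+ 2 <= G ^+ 2.
  by rewrite ler_pXn2r ?nnegrE ?(ltW G_gt0)// ltW.
apply: (@le_trans _ _ ((7 / 9) ^+ 2 * (th * tau) * (K2 * L * h) ^+ 2)); last first.
  by rewrite ler_wpM2l// !mulr_ge0 ?invr_ge0 ?sqr_ge0// ltW.
have bE : b ^+ 2 = m%:R * (L * h) ^+ 2 / 4.
  by rewrite exprMn sqr_sqrtr//; field.
rewrite exprMn bE K2E.
have -> : (7 / 9) ^+ 2 * (th * tau) * (6 / tau * m%:R ^+ 2 * (kap + 1) * L * h) ^+ 2
  = (kap + 1) ^+ 2 * (m%:R * (L * h) ^+ 2 / 4) * ((7 / 9) ^+ 2 * 144 * m%:R ^+ 3 * (th / tau)).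
  by field; rewrite gt_eqF.
rewrite ler_peMr//.
  by rewrite mulr_ge0 ?sqr_ge0// divr_ge0// mulr_ge0 ?sqr_ge0.
have m8 : 8 <= m%:R ^+ 3 :> R.
  have -> : 8 = 2%:R ^+ 3 :> R by ring.
  by rewrite ler_pXn2r ?nnegrE// ler_nat.
have tt : 1 / 696 <= th / tau by rewrite ler_pdivlMr//; move: th_tau; rewrite -/B0 -/tau; lra.
apply: (@le_trans _ _ ((7 / 9) ^+ 2 * 144 * 8 * (1 / 696))); first by lra.
have c0 : 0 <= (7 / 9) ^+ 2 * 144 :> R by lra.
move: ((7 / 9) ^+ 2 * 144) (m%:R ^+ 3) (th / tau) c0 m8 tt => e x1 y e0 x8 y0.
rewrite -!mulrA; apply: (ler_wpM2l e0).
have w0 : 0 <= 1 / 696 :> R by rewrite divr_ge0 ?ler0n ?ler01.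
exact: (ler_pM (ler0n R 8) w0 x8 y0).
Qed.

(** The last column of A has a scalar product of order sqrt (th tau) |g| with the
    gradient g, so fd_grad along A is at least two thirds of that, the last third
    paying for the discretization; the sufficient decrease then applies. The
    constant 1/4 is a lower bound of (2/3 * 7/9)^2. *)
Lemma run_gain : c * alpha_bar m beta c M2 L * M1 * (th * tau / 4) * G ^+ 2
  <= f x - f x'.
Proof.
set u := fd_grad h f A x.
have err : enorm (u - A^T *m g) <= b.
  exact: (fd_grad_error_norm f_diff L_gt0 grad_lip _ h_gt0 A1).
have uW : W - b <= enorm u.
  by have := enormB_ge (A^T *m g) u; move: err; rewrite -enormN opprB -/W; lra.
have b0 : 0 <= b by rewrite mulr_ge0 ?sqrtr_ge0 ?divr_ge0 ?mulr_ge0// ltW.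
have uk : kap * b <= enorm u by apply: le_trans uW; have := W_large; lra.
have u_large : M2 * b <= c * M1 * enorm u.
  have -> : M2 * b = c * M1 * (kap * b).
    by rewrite /kap; field; rewrite !gt_eqF.
  by rewrite ler_pM2l ?mulr_gt0.
have m_gt0 : (0 < m)%N by exact: ltnW.
have ab0 : 0 <= alpha_bar m beta c M2 L.
  have M2_gt0 := lt_le_trans M1_gt0 M1_le_M2.
  have c2 : 0 <= 1 - 2 * c by rewrite subr_ge0 mulrC -ler_pdivlMr// ltW.
  rewrite /alpha_bar le_min ler01/= divr_ge0//.
    by case/andP: beta01 => /ltW b0' _; rewrite mulr_ge0// mulr_ge0.
  by rewrite !mulr_ge0// ltW.
apply: le_trans (run_decrease f_diff L_gt0 grad_lip m_gt0 beta01 c_gt0 c_lt_half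
  M1_gt0 M1_le_M2 h_gt0 A1 HM ls x'E u_large).
have s0 : 0 <= c * alpha_bar m beta c M2 L * M1 by rewrite !mulr_ge0// ltW.
rewrite -[leLHS]mulrA ler_wpM2l//.
have b3 : b <= W / 3.
  have : 3 * b <= (kap + 1) * b by rewrite ler_wpM2r//; have := kap_ge2; lra.
  by have := W_large; lra.
have W0 : 0 <= W by exact: enorm_ge0.
have u2 : (2 / 3 * W) ^+ 2 <= enorm u ^+ 2.
  rewrite ler_pXn2r ?nnegrE ?enorm_ge0//; by move: uW b3; lra.
apply: le_trans u2; rewrite exprMn.
have tG : 0 <= th * tau * G ^+ 2.
  by rewrite mulr_ge0 ?sqr_ge0// mulr_ge0 ?divr_ge0 ?(ltW th_gt0) ?(ltW B0_gt0).
have -> : th * tau / 4 * G ^+ 2 = (th * tau * G ^+ 2) / 4 by ring.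
move: W_sqr tG; rewrite -mulrA; move: (th * tau * G ^+ 2) (W ^+ 2) => X Y.
by lra.
Qed.

End iteration_gain.

(** * Rotation invariance of the Gaussian law *)

Section gaussian_rotation.
Context {R : realType}.
Local Open Scope ereal_scope.
Notation mu := (@lebesgue_measure R).
Notation N := (@normal_prob R 0 1).
Notation pdf := (@normal_pdf R 0 1).

Let affine (a b : R) : measurableTypeR R -> measurableTypeR R :=
  fun y => (a * y + b)%R.

Let measurable_affine a b : measurable_fun [set: measurableTypeR R] (affine a b).
Proof. by apply: measurable_funD => //; exact: measurable_funM. Qed.

Lemma lebesgue_affine (a b : R) (A : set (measurableTypeR R)) : a != 0%R ->
  measurable A -> mu A = `|a|%:E * mu (affine a b @^-1` A).
Proof.
move=> a0 mA.
pose m_ : {measure set (measurableTypeR R) -> \bar R} :=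
  mscale (NngNum (normr_ge0 a)) (pushforward mu (affine a b)).
pose m' := m_ (measurable_affine a b).
rewrite -[RHS]/(m' A); apply: lebesgue_measure_unique => // _ [[s t] _ <-].
rewrite /m' /m_ /= /mscale /= /pushforward.
have ap : (0 < `|a|)%R by rewrite normr_gt0.
have sub (u v : R) : ((u - b) / a - (v - b) / a = (u - v) / a)%R.
  by rewrite -mulrBl opprB addrA subrK.
have [a_gt0|a_lt0|aE] := ltgtP 0%R a; last by rewrite -aE eqxx in a0.
- have -> : affine a b @^-1` `]s, t] = `] ((s - b) / a)%R, ((t - b) / a)%R ]%classic.
    apply/seteqP; split => y; rewrite /= /affine !in_itv/=;
    by rewrite ltr_pdivrMr// ler_pdivlMr// ltrBlDr lerBrDr (mulrC y).
  rewrite !lebesgue_measure_itv/= !lte_fin ltr_pM2r ?invr_gt0// ltrD2r.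
  case: ifP => st; last by rewrite mule0.
  by rewrite -!EFinB -EFinM sub gtr0_norm// mulrC divfK.
- have -> : affine a b @^-1` `]s, t] = `[ ((t - b) / a)%R, ((s - b) / a)%R [%classic.
    apply/seteqP; split => y; rewrite /= /affine !in_itv/=;
    by rewrite ler_ndivrMr// ltr_ndivlMr// lerBrDr ltrBlDr (mulrC y) andbC.
  rewrite !lebesgue_measure_itv/= !lte_fin ltr_nM2r ?invr_lt0// ltrD2r.
  case: ifP => st; last by rewrite mule0.
  rewrite -!EFinB -EFinM sub ltr0_norm//; congr EFin.
  by rewrite mulrC mulrN divfK// opprB.
Qed.

Lemma integral_affine (a b : R) (F : measurableTypeR R -> \bar R) : a != 0%R ->
  measurable_fun setT F -> (forall y, 0 <= F y) ->
  \int[mu]_y F y = `|a|%:E * \int[mu]_y F (a * y + b)%R.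
Proof.
move=> a0 mF F0.
pose m_ : {measure set (measurableTypeR R) -> \bar R} :=
  mscale (NngNum (normr_ge0 a)) (pushforward mu (affine a b)).
pose m' := m_ (measurable_affine a b).
transitivity (\int[m']_y F y).
  by apply: eq_measure_integral => A mA _; exact: (lebesgue_affine b a0 mA).
rewrite ge0_integral_mscale//=; congr (_ * _).
by rewrite ge0_integral_pushforward//; exact: measurable_affine.
Qed.

(** The Gaussian density is the Radon-Nikodym derivative of the Gaussian law;
    the bound on F gives the integrability that the change of measure asks for. *)
Lemma integral_normal01 (F : measurableTypeR R -> \bar R) : measurable_fun setT F ->
  (forall x, 0 <= F x <= 1) ->
  \int[N]_x F x = \int[mu]_x (F x * (pdf x)%:E).
Proof.
move=> mF F01.
have dom : N `<< mu by exact: normal_prob_dominates.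
rewrite -(Radon_Nikodym_change_of_variables dom)//=; last first.
  apply/integrableP; split => //; apply: (@le_lt_trans _ _ (\int[N]_x cst 1 x)).
    apply: ge0_le_integral => //=; first exact: measurableT_comp.
    by move=> x _; have /andP[F0 F1] := F01 x; rewrite gee0_abs.
  by rewrite integral_cst//= mul1e probability_setT ltry.
apply: ae_eq_integral => //.
- apply: (emeasurable_funM mF); apply: (measurable_int mu).
  by apply Radon_Nikodym_integrable; exact: dom.
- have mp : measurable_fun setT (fun x : measurableTypeR R => (pdf x)%:E).
    by apply/measurable_EFinP; exact: measurable_normal_pdf.
  exact (emeasurable_funM mF mp).
- apply: ae_eqe_mul2l => /=.
  rewrite Radon_NikodymE//=; case: cid => /= k [k1 k2 k3].
  apply: integral_ae_eq => //=.
  + by apply/measurable_EFinP; exact: (@measurable_normal_pdf R 0 1).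
  + by move=> E E01 mE; rewrite -k3.
Qed.

Let measurable_pdf (d' : measure_display) (T' : measurableType d') (u : T' -> R) :
  measurable_fun setT u -> measurable_fun setT (fun t => pdf (u t)).
Proof. by move=> mu_; apply: (measurableT_comp (measurable_normal_pdf 0 1)). Qed.

(** The rotation (x, y) |-> ((a x + b y) / c, (b x - a y) / c) preserves
    x^2 + y^2; it is written here in terms of x and z = (a x + b y) / c. *)
Let pdf_rot (a b c x z : R) : b != 0%R -> (c ^+ 2 = a ^+ 2 + b ^+ 2)%R ->
  (pdf x * pdf (c / b * z + - (a * x / b)) =
   pdf z * pdf (c / b * x + - (a * z / b)))%R.
Proof.
move=> b0 cE; rewrite normal_pdfE ?oner_neq0//= /normal_fun.
rewrite mulrACA [RHS]mulrACA -!expRD; congr (_ * expR _)%R.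
rewrite !subr0.
have -> : ((c / b * z - a * x / b) ^+ 2 = (c ^+ 2 * z ^+ 2 + a ^+ 2 * x ^+ 2
  - 2 * a * c * x * z) / b ^+ 2)%R by field.
have -> : ((c / b * x - a * z / b) ^+ 2 = (c ^+ 2 * x ^+ 2 + a ^+ 2 * z ^+ 2
  - 2 * a * c * x * z) / b ^+ 2)%R by field.
by rewrite cE; field.
Qed.

(** Fubini, the one-dimensional substitution y = (c z - a x) / b, and Fubini
    again: after the substitution the product of the two densities splits into a
    density in z and one in x with z fixed, and the latter integrates to 1. *)
Lemma normal_rotation (a b : R) (B : set (measurableTypeR R)) : measurable B ->
  (N \x N) [set z | B (a * z.1 + b * z.2)%R] =
  N [set z | B (Num.sqrt (a ^+ 2 + b ^+ 2) * z)%R].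
Proof.
move=> mB; set c := Num.sqrt _.
have cE : (c ^+ 2 = a ^+ 2 + b ^+ 2)%R by rewrite sqr_sqrtr// addr_ge0 ?sqr_ge0.
have mpdf := measurable_normal_pdf (0 : R) 1.
have ind01 t : (0 <= (\1_B t : R) <= 1)%R by rewrite indicE; case: (_ \in _); rewrite /= ?lexx ?ler01.
have NE (u : R -> R) : measurable_fun [set: measurableTypeR R] u ->
    N [set y | B (u y)] = \int[mu]_y (\1_B (u y) * pdf y)%:E.
  move=> mu_.
  rewrite /normal_prob integral_mkcond; apply: eq_integral => y _.
  rewrite patchE indicE -[RHS]/((((u y \in B)%:R * pdf y)%R)%:E).
  have -> : (u y \in B) = (y \in [set y | B (u y)]).
    by apply/idP/idP => /set_mem By; apply/mem_set.
  by case: ifP => _; rewrite ?mul1r ?mul0r.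
have mlin : measurable_fun [set: (measurableTypeR R * measurableTypeR R)%type]
    (fun z => a * z.1 + b * z.2 : measurableTypeR R)%R.
  by apply: measurable_funD; apply: measurable_funM.
have mD : measurable [set z : measurableTypeR R * measurableTypeR R | B (a * z.1 + b * z.2)%R].
  by rewrite -[X in measurable X]setTI; exact: mlin.
have mind (d' : measure_display) (T' : measurableType d') (u : T' -> measurableTypeR R) :
    measurable_fun setT u -> measurable_fun setT (fun t => \1_B (u t) : R).
  by move=> mu_; apply: measurableT_comp => //; exact: measurable_indic.
pose inner (x : R) := \int[mu]_y (\1_B (a * x + b * y)%R * pdf y)%:E.
have innerE x : N (xsection [set z | B (a * z.1 + b * z.2)%R] x) = inner x.
  rewrite /xsection/= /inner -NE.
    by congr (N _); apply/seteqP; split => y; rewrite /= inE.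
  by apply: measurable_funD => //; apply: measurable_funM.
have inner01 x : 0 <= inner x <= 1.
  by rewrite -innerE measure_ge0 probability_le1//; exact: measurable_xsection.
have minner : measurable_fun [set: measurableTypeR R] inner.
  rewrite (_ : inner = N \o xsection [set z | B (a * z.1 + b * z.2)%R]).
    exact: measurable_fun_xsection.
  by apply/funext => x /=; rewrite innerE.
have -> : (N \x N) [set z | B (a * z.1 + b * z.2)%R] = \int[mu]_x (inner x * (pdf x)%:E).
  rewrite -(integral_normal01 minner inner01); apply: eq_integral => x _.
  exact: innerE.
have [b0|b0] := eqVneq b 0%R.
  have inner0 x : inner x = (\1_B (a * x)%R)%:E.
    rewrite /inner b0; under eq_integral do rewrite mul0r addr0 EFinM.
    rewrite ge0_integralZl//; last 2 first.
    - by apply/measurable_EFinP; exact: mpdf.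
    - by move=> y _; rewrite lee_fin normal_pdf_ge0.
    by rewrite integral_normal_pdf mule1.
  rewrite NE; last exact: measurable_funM.
  have -> : c = `|a|%R by rewrite /c b0 expr0n addr0 sqrtr_sqr.
  have [a0|a0] := leP 0%R a.
    by apply: eq_integral => x _; rewrite inner0 ger0_norm.
  have n10 : (- 1 != 0 :> R)%R by rewrite oppr_eq0 oner_neq0.
  rewrite [RHS](integral_affine 0 n10); last 2 first.
  - apply/measurable_EFinP; apply: measurable_funM => //.
    by apply: mind; exact: measurable_funM.
  - by move=> y; rewrite lee_fin mulr_ge0 ?normal_pdf_ge0//; have /andP[] := ind01 (`|a| * y)%R.
  rewrite normrN1 mul1e; apply: eq_integral => x _.
  rewrite inner0 ltr0_norm// addr0 mulN1r mulrNN -EFinM; congr (_ * _)%:E.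
  by rewrite !normal_pdfE ?oner_neq0// /normal_fun !subr0 sqrrN.
have c0 : (0 < c)%R by rewrite sqrtr_gt0 ltr_wpDl ?sqr_ge0// exprn_even_gt0.
have cb0 : (c / b != 0)%R by rewrite mulf_neq0 ?invr_eq0// gt_eqF.
have mcz : measurable_fun [set: measurableTypeR R] (fun z => c * z : measurableTypeR R)%R.
  exact: measurable_funM.
have [G GE] : {G : R -> R -> R | forall x z, G x z =
    ((\1_B (c * z) * pdf z) * pdf (c / b * x + - (a * z / b)))%R} by eexists.
have stepx x : inner x * (pdf x)%:E = `|c / b|%:E * \int[mu]_z (G x z)%:E.
  rewrite /inner (integral_affine (- (a * x / b)) cb0); last 2 first.
  - apply/measurable_EFinP; apply: measurable_funM => //.
    by apply: mind; apply: measurable_funD => //; apply: measurable_funM.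
  - by move=> y; rewrite lee_fin mulr_ge0 ?normal_pdf_ge0//; have /andP[] := ind01 (a * x + b * y)%R.
  under eq_integral => y _.
    rewrite (_ : (a * x + b * (c / b * y + - (a * x / b)) = c * y)%R); last by field.
    over.
  rewrite -muleA; congr (_ * _).
  rewrite -ge0_integralZr//; last 3 first.
  - apply/measurable_EFinP; apply: measurable_funM; first exact: mind.
    by apply: measurable_pdf; apply: measurable_funD => //; exact: measurable_funM.
  - by move=> y _; rewrite lee_fin mulr_ge0 ?normal_pdf_ge0//; have /andP[] := ind01 (c * y)%R.
  - by rewrite lee_fin normal_pdf_ge0.
  apply: eq_integral => z _; rewrite -EFinM GE; congr EFin.
  by rewrite [LHS]mulrAC -[LHS]mulrA (pdf_rot x z b0 cE) [LHS]mulrA.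
have mG : measurable_fun [set: (measurableTypeR R * measurableTypeR R)%type]
    (fun p => (G p.1 p.2)%:E).
  under eq_fun do rewrite GE.
  apply/measurable_EFinP; apply: measurable_funM; first apply: measurable_funM.
  - by apply: mind; exact: measurable_funM.
  - exact: measurable_pdf.
  - apply: measurable_pdf; apply: measurable_funD; first exact: measurable_funM.
    apply: measurable_funN; apply: measurable_funM => //; exact: measurable_funM.
have G0 p : 0 <= (G p.1 p.2)%:E.
  by rewrite lee_fin GE !mulr_ge0 ?normal_pdf_ge0//; have /andP[] := ind01 (c * p.2)%R.
under eq_integral do rewrite stepx.
rewrite ge0_integralZl//; last 2 first.
- exact: (measurable_fun_fubini_tonelli_F (m2 := mu) _ mG G0).
- by move=> x _; apply: integral_ge0 => z _; exact: (G0 (x, z)).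
rewrite (fubini_tonelli (m1 := mu) (m2 := mu) _ mG G0)/=.
rewrite -ge0_integralZl//; last 2 first.
- exact: (measurable_fun_fubini_tonelli_G (m1 := mu) _ mG G0).
- by move=> x _; apply: integral_ge0 => z _; exact: (G0 (z, x)).
rewrite NE//; apply: eq_integral => z _.
under eq_integral do rewrite GE EFinM.
rewrite ge0_integralZl//; last 3 first.
- by apply/measurable_EFinP; apply: measurable_pdf; apply: measurable_funD => //; exact: measurable_funM.
- by move=> y _; rewrite lee_fin normal_pdf_ge0.
- by rewrite lee_fin mulr_ge0 ?normal_pdf_ge0//; have /andP[] := ind01 (c * z)%R.
rewrite muleCA -(integral_affine (- (a * z / b)) cb0 (F := fun x => (pdf x)%:E)).
- by rewrite integral_normal_pdf mule1.
- by apply/measurable_EFinP; exact: mpdf.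
- by move=> y; rewrite lee_fin normal_pdf_ge0.
Qed.

End gaussian_rotation.

(** * Linear combinations of independent Gaussians *)

Section rectangles.
Local Open Scope ereal_scope.

(** Rectangles are a pi-system generating the product sigma-algebra. *)
Lemma eq_measure_rectangles d1 d2 (T1 : measurableType d1) (T2 : measurableType d2)
    (R : realType) (m1 m2 : {measure set (T1 * T2) -> \bar R}) :
  m1 setT < +oo ->
  (forall A B, measurable A -> measurable B -> m1 (A `*` B) = m2 (A `*` B)) ->
  forall X, measurable X -> m1 X = m2 X.
Proof.
move=> m1oo m12 X mX.
pose C : set (set (T1 * T2)) := [set A `*` B | A in measurable & B in measurable].
apply: (measure_unique C (fun=> setT)) => //.
- by rewrite measurable_prod_measurableType.
- move=> _ _ [A1 mA1 [B1 mB1 <-]] [A2 mA2 [B2 mB2 <-]]; rewrite -setXI.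
  exists (A1 `&` A2); first exact: measurableI.
  by exists (B1 `&` B2); first exact: measurableI.
- move=> _; exists setT; first exact: measurableT.
  by exists setT; rewrite ?setXTT.
- by apply/seteqP; split => // x _; exists 0%N.
- by move=> _ [A mA [B mB <-]]; exact: m12.
Qed.

End rectangles.

Section gaussian_combination.
Context {R : realType} d (T : measurableType d) (P : probability T R) (n : nat).
Variable X : 'I_n -> T -> measurableTypeR R.
Notation N := (@normal_prob R 0 1).
Hypothesis mX : forall i, measurable_fun setT (X i).
Hypothesis PX : forall B : 'I_n -> set (measurableTypeR R),
  (forall i, measurable (B i)) ->
  P [set w | forall i, B i (X i w)] = (\prod_i fine (N (B i)))%:E.
Variable x : 'I_n -> R.

Let S (k : nat) (w : T) : measurableTypeR R := \sum_(i < n | (i < k)%N) x i * X i w.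
Let s (k : nat) : R := Num.sqrt (\sum_(i < n | (i < k)%N) x i ^+ 2).
Let E (k : nat) (Bs : 'I_n -> set (measurableTypeR R)) : set T :=
  [set w | forall i : 'I_n, (k <= i)%N -> Bs i (X i w)].

Let mS k : measurable_fun setT (S k).
Proof.
have -> : S k = fun w => \sum_(i < n) (if (i < k)%N then x i else 0) * X i w.
  apply/funext => w; rewrite /S big_mkcond; apply: eq_bigr => i _.
  by case: ifP; rewrite ?mul0r.
by apply: measurable_sum => i; apply: measurable_funM => //; exact: mX.
Qed.

Let mE k Bs : (forall i, measurable (Bs i)) -> measurable (E k Bs).
Proof.
move=> mB; have -> : E k Bs = \bigcap_(i in [set: 'I_n])
    (if (k <= i)%N then X i @^-1` Bs i else setT).
  apply/seteqP; split => w.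
    by move=> Ew i _; case: ifP => // ki; exact: Ew.
  by move=> Ew i ki; have := Ew i Logic.I; rewrite ki.
apply: fin_bigcap_measurable => // i _; case: ifP => // _.
by rewrite -[X in measurable X]setTI; exact: mX.
Qed.

(** The induction adds one coordinate at a time. It keeps the events on the
    remaining coordinates in the statement, which expresses that the partial sum
    is independent of them; the new partial sum is then a function of two
    independent Gaussians, and normal_rotation applies. *)
Let law k : (k <= n)%N -> forall (B : set (measurableTypeR R)) Bs,
  measurable B -> (forall i, measurable (Bs i)) ->
  P ([set w | B (S k w)] `&` E k Bs) =
  (N [set z | B (s k * z)%R] * (\prod_(i < n | (k <= i)%N) fine (N (Bs i)))%R%:E)%E.
Proof.
elim: k => [_|k IH kn] B Bs mB mBs.
  have S0 w : S 0 w = 0 by apply: big1.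
  have s0 z : s 0 * z = 0 by rewrite /s big1// sqrtr0 mul0r.
  have E0 : P (E 0 Bs) = (\prod_(i < n) fine (N (Bs i)))%:E.
    rewrite -PX//; congr (P _); apply/seteqP; split => w Ew i; first exact: Ew.
    by move=> _; exact: Ew.
  have [B0|B0] := pselect (B 0).
    have -> : [set w | B (S 0 w)] = setT by apply/seteqP; split => w //= _; rewrite S0.
    have -> : [set z | B (s 0 * z)] = setT by apply/seteqP; split => w //= _; rewrite s0.
    by rewrite setTI probability_setT mul1e.
  have -> : [set w | B (S 0 w)] = set0 by apply/seteqP; split => w //=; rewrite S0.
  have -> : [set z | B (s 0 * z)] = set0 by apply/seteqP; split => w //=; rewrite s0.
  by rewrite set0I !measure0 mul0e.
pose ik := Ordinal kn.
have predE (i : 'I_n) : ((i < k.+1) = (i < k) || (i == ik))%N.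
  by rewrite ltnS leq_eqVlt orbC.
have SE w : S k.+1 w = S k w + x ik * X ik w.
  rewrite /S (bigD1 ik)/= ?ltnS// addrC; congr (_ + _); apply: eq_bigl => i.
  rewrite predE; case: (eqVneq i ik) => [->|]; rewrite ?ltnn ?andbF ?orbF ?andbT//.
have sE : s k.+1 = Num.sqrt (s k ^+ 2 + x ik ^+ 2).
  rewrite /s sqr_sqrtr; last by apply: sumr_ge0 => i _; exact: sqr_ge0.
  congr Num.sqrt; rewrite (bigD1 ik)/= ?ltnS// addrC; congr (_ + _).
  apply: eq_bigl => i.
  rewrite predE; case: (eqVneq i ik) => [->|]; rewrite ?ltnn ?andbF ?orbF ?andbT//.
have prodE (Cs : 'I_n -> set (measurableTypeR R)) :
    \prod_(i < n | (k <= i)%N) fine (N (Cs i)) =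
    fine (N (Cs ik)) * \prod_(i < n | (k.+1 <= i)%N) fine (N (Cs i)).
  rewrite (bigD1 ik)//=; congr (_ * _); apply: eq_bigl => i.
  by rewrite ltn_neqAle andbC eq_sym.
pose c := \prod_(i < n | (k.+1 <= i)%N) fine (N (Bs i)).
have c0 : 0 <= c by apply: prodr_ge0 => i _; rewrite fine_ge0.
have mpair : measurable_fun setT (fun w => (S k w, X ik w)).
  exact: measurable_fun_pair.
pose phi (z : measurableTypeR R * measurableTypeR R) :
  measurableTypeR R * measurableTypeR R := (s k * z.1, z.2).
have mphi : measurable_fun setT phi.
  by apply: measurable_fun_pair => //; exact: measurable_funM.
pose m1_ : {measure set (measurableTypeR R * measurableTypeR R) -> \bar R} :=
  pushforward (mrestr P (mE k.+1 mBs)) (fun w => (S k w, X ik w)).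
pose m2_ : {measure set (measurableTypeR R * measurableTypeR R) -> \bar R} :=
  mscale (NngNum c0) (pushforward (N \x N)%E phi).
pose D := [set p : measurableTypeR R * measurableTypeR R | B (p.1 + x ik * p.2)].
have mD : measurable D.
  rewrite -[X in measurable X]setTI.
  have mlin : measurable_fun setT
      (fun p : measurableTypeR R * measurableTypeR R => p.1 + x ik * p.2 : measurableTypeR R).
    by apply: measurable_funD => //; exact: measurable_funM.
  exact: mlin.
have -> : P ([set w | B (S k.+1 w)] `&` E k.+1 Bs) = m1_ mpair D.
  by congr (P (_ `&` _)); apply/seteqP; split => w; rewrite /= SE.
rewrite (@eq_measure_rectangles _ _ _ _ _ (m1_ mpair) (m2_ mphi))//.
- rewrite /m2_ /= /mscale /= /pushforward /= muleC; congr (_ * _)%E.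
  by rewrite sE -normal_rotation.
- rewrite /m1_ /= /pushforward /mrestr preimage_setT setTI.
  by apply: (@le_lt_trans _ _ 1%E); [exact: probability_le1 (mE _ mBs) | rewrite ltry].
- move=> A C mA mC; rewrite /m1_ /m2_ /= /mscale /= /pushforward /= /mrestr.
  pose Cs (i : 'I_n) := if i == ik then C else Bs i.
  have mCs i : measurable (Cs i) by rewrite /Cs; case: ifP.
  have -> : ((fun w => (S k w, X ik w)) @^-1` (A `*` C)) `&` E k.+1 Bs =
      [set w | A (S k w)] `&` E k Cs.
    apply/seteqP; split => w /=.
      move=> [[Aw Cw] Ew]; split => // i ki; rewrite /Cs; case: eqVneq => [->//|ni].
      by apply: Ew; rewrite ltn_neqAle ki andbT eq_sym.
    move=> [Aw Ew]; split; first split => //.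
      by have := Ew ik (leqnn _); rewrite /Cs eqxx.
    move=> i ki; have := Ew i (ltnW ki); rewrite /Cs; case: eqVneq => // ii.
    by move: ki; rewrite ii ltnn.
  rewrite (IH (ltnW kn))// prodE /Cs eqxx.
  rewrite (eq_bigr (fun i => fine (N (Bs i)))); last first.
    by move=> i ki; case: eqVneq ki => // ->; rewrite ltnn.
  have -> : phi @^-1` (A `*` C) = [set z : measurableTypeR R | A (s k * z)] `*` C.
    by apply/seteqP; split.
  have mAs : measurable [set z : measurableTypeR R | A (s k * z)].
    rewrite -[X in measurable X]setTI.
    have msc : measurable_fun setT (fun z : measurableTypeR R => s k * z : measurableTypeR R).
      exact: measurable_funM.
    exact: msc.
  rewrite product_measure1E// EFinM fineK ?fin_num_measure//.
  by rewrite muleA muleC.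
Qed.

(** The law of a linear combination of independent N(0,1) variables is that of
    |x| times one of them; scaling by |x|, rather than a Gaussian law with that
    deviation, also covers x = 0. *)
Lemma normal_combination (B : set (measurableTypeR R)) : measurable B ->
  P [set w | B (\sum_i x i * X i w)] =
  N [set z | B (Num.sqrt (\sum_i x i ^+ 2) * z)%R].
Proof.
move=> mB; have := law (leqnn n) mB (fun=> measurableT).
have -> : E n (fun=> setT) = setT by apply/seteqP; split.
rewrite setIT big1; last by move=> i _; rewrite probability_setT.
have sumE (F : 'I_n -> R) : \sum_(i < n | (i < n)%N) F i = \sum_i F i.
  by apply: eq_bigl => i; rewrite ltn_ord.
rewrite mule1 /s sumE => <-.
by congr (P _); apply/seteqP; split => w; rewrite /= /S sumE.
Qed.

End gaussian_combination.

(** * Measurability of matrix-valued functions *)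

Section matrix_measurability.
Context {R : realType} d (T : measurableType d).

(** Entrywise measurability, which is Borel measurability of F in view of
    measurable_continuous_mx. *)
Definition mxmeas a b (F : T -> 'M[R]_(a, b)) : Prop :=
  forall i j, measurable_fun [set: T] (fun w => F w i j).

(** An open set of matrices is a countable union of cubes with rational centres,
    and the preimage of a cube is a finite intersection of conditions on single
    entries. *)
Lemma measurable_continuous_mx a b (F : T -> 'M[R]_(a, b)) (phi : 'M[R]_(a, b) -> R) :
  mxmeas F -> continuous (phi : 'M[R]_(a, b) -> R^o) ->
  measurable_fun [set: T] (fun w => phi (F w)).
Proof.
move=> mF cphi.
apply: (@measurability _ _ _ (measurableTypeR R) _ _ _ (RGenOpens.measurableE R)).
move=> _ [U [s [t UE]] <-]; rewrite setTI.
have oU : open U by rewrite UE; exact: itv_open.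
pose O : set 'M[R]_(a, b) := phi @^-1` U.
have oO : open O by move/continuousP : cphi; exact.
pose box (p : 'M[rat]_(a, b) * nat) : set 'M[R]_(a, b) :=
  [set M | forall i j, `|ratr (p.1 i j) - M i j| < p.2.+1%:R^-1].
have OE : O = \bigcup_(p in [set p | box p `<=` O]) box p.
  apply/seteqP; split => [M OM|M [p /= pO]]; last exact: pO.
  have /nbhs_ballP[e /= e0 eO] : nbhs M O by exact: open_nbhs_nbhs.
  have [k ke] : exists k : nat, k.+1%:R^-1 < e / 2.
    have /cvgrPdist_lt := @cvg_harmonic R.
    have e2 : 0 < e / 2 by rewrite divr_gt0.
    move=> /(_ _ e2) [k _ /(_ k (leqnn _))] /=.
    by rewrite sub0r normrN ger0_norm ?invr_ge0//; exists k.
  have /(_ _ _)/cid2 q i j : exists2 q : rat, true & `|ratr q - M i j| < k.+1%:R^-1.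
    have kp : M i j - k.+1%:R^-1 < M i j + k.+1%:R^-1.
      by rewrite ltrBlDr -addrA ltrDl addr_gt0// invr_gt0.
    have /rat_in_itvoo[q] := kp; rewrite in_itv/= => /andP[q1 q2]; exists q => //.
    by rewrite ltr_distl q1.
  exists (\matrix_(i, j) sval (q i j), k); last first.
    by move=> i j; rewrite mxE/=; case: (q i j).
  move=> N /= boxN; apply: eO; split => // i j.
  have := boxN i j; rewrite mxE; case: (q i j) => /= r _ rM rN.
  rewrite /ball/= (splitr e) -(subrKA (ratr r)).
  rewrite (le_lt_trans (ler_normD _ _))// ltrD//.
    by rewrite distrC (lt_trans rM).
  by rewrite (lt_trans rN).
rewrite (_ : _ @^-1` U = \bigcup_(p in [set p | box p `<=` O]) (F @^-1` box p)); last first.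
  by rewrite -preimage_bigcup -OE.
rewrite bigcup_mkcond; apply: countable_bigcupT_measurable; first exact: countableP.
move=> p; case: ifP => // _.
have -> : F @^-1` box p = \bigcap_(i in [set: 'I_a]) \bigcap_(j in [set: 'I_b])
    [set w | `|ratr (p.1 i j) - F w i j| < p.2.+1%:R^-1].
  by apply/seteqP; split => w /= H i => [_ j _|]; [exact: H|move=> j; exact: H].
apply: fin_bigcap_measurable => // i _; apply: fin_bigcap_measurable => // j _.
have mn : measurable_fun [set: T] (fun w => `|ratr (p.1 i j) - F w i j|).
  by apply: measurableT_comp => //; exact: measurable_funB.
rewrite -[X in measurable X]setTI.
rewrite (_ : [set w | _] = (fun w => `|ratr (p.1 i j) - F w i j|) @^-1` `]-oo, p.2.+1%:R^-1[%classic).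
  exact: mn.
by apply/seteqP; split => w; rewrite /= in_itv.
Qed.

Lemma mxmeas_mul a b c (F : T -> 'M[R]_(a, b)) (G : T -> 'M[R]_(b, c)) :
  mxmeas F -> mxmeas G -> mxmeas (fun w => F w *m G w).
Proof.
move=> mF mG i j; under eq_fun do rewrite mxE.
by apply: measurable_sum => k; apply: measurable_funM; [exact: mF|exact: mG].
Qed.

Lemma mxmeasD a b (F G : T -> 'M[R]_(a, b)) :
  mxmeas F -> mxmeas G -> mxmeas (fun w => F w + G w).
Proof.
by move=> mF mG i j; under eq_fun do rewrite mxE; apply: measurable_funD; [exact: mF|exact: mG].
Qed.

Lemma mxmeasN a b (F : T -> 'M[R]_(a, b)) : mxmeas F -> mxmeas (fun w => - F w).
Proof. by move=> mF i j; under eq_fun do rewrite mxE; apply: measurable_funN; exact: mF. Qed.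

Lemma mxmeasZ a b (s : T -> R) (F : T -> 'M[R]_(a, b)) :
  measurable_fun [set: T] s -> mxmeas F -> mxmeas (fun w => s w *: F w).
Proof.
by move=> ms mF i j; under eq_fun do rewrite mxE; apply: measurable_funM; [exact: ms|exact: mF].
Qed.

Lemma mxmeas_tr a b (F : T -> 'M[R]_(a, b)) : mxmeas F -> mxmeas (fun w => (F w)^T).
Proof. by move=> mF i j; under eq_fun do rewrite mxE; exact: mF. Qed.

Lemma mxmeas_cst a b (M : 'M[R]_(a, b)) : mxmeas (fun=> M).
Proof. by move=> i j; exact: measurable_cst. Qed.

Lemma measurable_dotv n (F G : T -> 'cV[R]_n) : mxmeas F -> mxmeas G ->
  measurable_fun [set: T] (fun w => dotv (F w) (G w)).
Proof. by move=> mF mG; apply: measurable_sum => k; apply: measurable_funM; [exact: mF|exact: mG]. Qed.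

Lemma measurable_sqrt (s : T -> R) : measurable_fun [set: T] s ->
  measurable_fun [set: T] (fun w => Num.sqrt (s w)).
Proof.
move=> ms; apply: measurableT_comp ms.
by apply: continuous_measurable_fun; exact: sqrt_continuous.
Qed.

Lemma measurable_enorm n (F : T -> 'cV[R]_n) : mxmeas F ->
  measurable_fun [set: T] (fun w => enorm (F w)).
Proof. by move=> mF; apply: measurable_sqrt; exact: measurable_dotv. Qed.

Lemma measurable_inv (s : T -> R) : measurable_fun [set: T] s ->
  measurable_fun [set: T] (fun w => (s w)^-1).
Proof.
move=> ms.
have -> : (fun w => (s w)^-1) = (fun w => s w * (s w ^+ 2) `^ (-1)).
  apply/funext => w; rewrite powR_inv1 ?sqr_ge0//.
  have [->|s0] := eqVneq (s w) 0; first by rewrite invr0 mul0r.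
  by field.
apply: measurable_funM => //.
have mp : measurable_fun [set: R] (fun x : R => x `^ (-1)) by exact: measurable_powR.
by apply: (measurableT_comp mp); exact: measurable_funX.
Qed.

Lemma mxmeas_normalize n (F : T -> 'cV[R]_n) : mxmeas F ->
  mxmeas (fun w => normalize (F w)).
Proof.
by move=> mF; apply: mxmeasZ => //; apply: measurable_inv; exact: measurable_enorm.
Qed.

Lemma measurable_lt (u : T -> R) (a : R) : measurable_fun [set: T] u ->
  measurable [set w | u w < a].
Proof.
move=> mu; rewrite -[X in measurable X]setTI.
rewrite (_ : [set w | _] = u @^-1` `]-oo, a[%classic); first exact: mu.
by apply/seteqP; split => w; rewrite /= in_itv.
Qed.

Lemma measurable_le (u : T -> R) (a : R) : measurable_fun [set: T] u ->
  measurable [set w | u w <= a].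
Proof.
move=> mu; rewrite -[X in measurable X]setTI.
rewrite (_ : [set w | _] = u @^-1` `]-oo, a]%classic); first exact: mu.
by apply/seteqP; split => w; rewrite /= in_itv.
Qed.

End matrix_measurability.

(** * Small balls of the Gaussian law *)

Section small_ball.
Context {R : realType}.

(** The sine s of pi / 6 satisfies 3 s - 4 s^3 = 1, that is
    (2 s - 1)^2 (s + 1) = 0, hence s = 1/2; and sin t <= t. *)
Lemma pi_ge3 : 3 <= pi :> R.
Proof.
have sin_le (t : R) : 0 <= t -> sin t <= t.
  move=> t0.
  have [c _] : exists2 c, c \in `[0, t]%R &
      (t - sin t) - (0 - sin 0) = (1 - cos c) * (t - 0).
    apply: (@MVT_segment R (fun u => u - sin u) (fun u => 1 - cos u)) => //.
    apply: continuous_subspaceT => u; apply: cvgB; first exact: cvg_id.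
    exact: continuous_sin.
  rewrite sin0 !subr0 => E.
  by rewrite -subr_ge0 E mulr_ge0// subr_ge0 cos_le1.
pose t : R := pi / 6; pose s := sin t.
have t0 : 0 < t by rewrite divr_gt0// pi_gt0.
have s_gt0 : 0 < s.
  apply: sin_gt0_pihalf; rewrite t0/= /t ltr_pM2l ?pi_gt0//.
  by rewrite ltf_pV2 ?posrE// ltr_nat.
have : sin (t *+ 2 + t) = 1.
  have -> : t *+ 2 + t = pi / 2 by rewrite /t -mulr_natr; field.
  exact: sin_pihalf.
rewrite sinD sin_mulr2n cos_mulr2n; have := cos2Dsin2 t; rewrite -/s.
move: (cos t) => c cs E.
have c2 : c ^+ 2 = 1 - s ^+ 2 by rewrite -cs addrK.
have {E} : 3 * s - 4 * s ^+ 3 = 1.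
  have E' : (c * s) *+ 2 * c + (c ^+ 2 *+ 2 - 1) * s = 4 * c ^+ 2 * s - s by ring.
  by apply: etrans E; rewrite -/s E' c2; ring.
move=> E; have : (2 * s - 1) ^+ 2 * (s + 1) = 0.
  have -> : (2 * s - 1) ^+ 2 * (s + 1) = 1 - (3 * s - 4 * s ^+ 3) by ring.
  by rewrite E subrr.
move/eqP; rewrite mulf_eq0 sqrf_eq0 => /orP[/eqP s2|/eqP s1]; last by move: s_gt0; lra.
have := sin_le t (ltW t0); rewrite -/s /t; move: s2; lra.
Qed.

(** The density is at most 1 / sqrt (2 pi) <= 41/100, on an interval of length
    2 r. *)
Lemma normal_small_ball (r : R) : 0 <= r ->
  (normal_prob 0 1 [set z : R | (z ^+ 2 < r ^+ 2)%R] <= (82 / 100 * r)%:E)%E.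
Proof.
move=> r0.
have sub : [set z : R | z ^+ 2 < r ^+ 2] `<=` `[- r, r]%classic.
  move=> z /=; rewrite in_itv/= -ler_norml -(ger0_norm (sqr_ge0 z)).
  by rewrite normrX ltr_pXn2r ?nnegrE// => /ltW.
have mS : measurable [set z : R | z ^+ 2 < r ^+ 2].
  rewrite -[X in measurable X]setTI.
  rewrite (_ : [set z | _] = (fun z : R => z ^+ 2) @^-1` `]-oo, r ^+ 2[%classic).
    exact: exprn_measurable.
  by apply/seteqP; split => z; rewrite /= in_itv.
pose I : set (measurableTypeR R) := `[- r, r]%classic.
apply: (@le_trans _ _ (normal_prob 0 1 I)).
  apply: le_measure; rewrite ?inE; [exact: mS|exact: measurable_itv|exact: sub].
rewrite /normal_prob.
apply: (@le_trans _ _ (\int[lebesgue_measure]_(x in I) (normal_peak 1)%:E)%E).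
  apply: ge0_le_integral => //.
  - exact: measurable_itv.
  - by move=> z _; rewrite lee_fin normal_pdf_ge0.
  - by apply/measurable_EFinP; apply: measurable_funTS; exact: measurable_normal_pdf.
  - by move=> z _; rewrite lee_fin normal_pdf_ub// oner_neq0.
rewrite integral_cst//; last exact: measurable_itv.
rewrite /I/= lebesgue_measure_itv/= lte_fin.
case: ifP => _; last by rewrite mule0 lee_fin mulr_ge0.
rewrite -EFinB -EFinM lee_fin opprK.
have peak : normal_peak 1 <= 41 / 100 :> R.
  rewrite /normal_peak expr1n mul1r -mulr_natr.
  have h6 : 0 < pi * 2%:R :> R by rewrite mulr_gt0// pi_gt0.
  have c0 : 0 < 100 / 41 :> R by lra.
  have key : 100 / 41 <= Num.sqrt (pi * 2%:R) :> R.
    rewrite -(@ler_pXn2r _ 2) ?nnegrE ?sqrtr_ge0 ?(ltW c0)//.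
    by rewrite sqr_sqrtr ?(ltW h6)//; have := pi_ge3; lra.
  have -> : 41 / 100 = (100 / 41)^-1 :> R by rewrite invf_div.
  by rewrite lef_pV2 ?posrE// sqrtr_gt0.
have -> : normal_peak 1 * (r + r) = 2 * normal_peak 1 * r by ring.
by rewrite ler_wpM2r//; move: peak; lra.
Qed.

End small_ball.

(** * Sketches are rarely small *)

Section sketch.
Context {R : realType} disp (T : measurableType disp) (P : probability T R).
Variables (n d : nat) (Q : T -> 'M[R]_(n, d)).
Hypothesis gQ : gaussian_matrix P Q.

Lemma gaussian_mxmeas : mxmeas Q.
Proof. by move=> i j; case: gQ => mQ _ _; exact: mQ. Qed.

Lemma column_small_ball (x : 'cV[R]_n) (j : 'I_d) (r : R) : 0 <= r ->
  0 < enorm x ->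
  (P [set w | (((Q w)^T *m x) j 0 ^+ 2 < r ^+ 2 * enorm x ^+ 2)%R]
    <= (82 / 100 * r)%:E)%E.
Proof.
move=> r0 x0; case: gQ => mQ QN Qprod.
pose X (i : 'I_n) (w : T) : measurableTypeR R := Q w i j.
pose B : set (measurableTypeR R) := [set t | t ^+ 2 < r ^+ 2 * enorm x ^+ 2].
have mB : measurable B.
  rewrite -[X in measurable X]setTI.
  rewrite (_ : B = (fun z : R => z ^+ 2) @^-1` `]-oo, r ^+ 2 * enorm x ^+ 2[%classic).
    exact: exprn_measurable.
  by apply/seteqP; split => z; rewrite /= in_itv.
have mX i : measurable_fun setT (X i) by exact: mQ.
have PX (Bs : 'I_n -> set (measurableTypeR R)) : (forall i, measurable (Bs i)) ->
    P [set w | forall i, Bs i (X i w)] = (\prod_i fine (normal_prob 0 1 (Bs i)))%:E.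
  move=> mBs.
  pose Cs (i : 'I_n) (l : 'I_d) : set R := if l == j then Bs i else setT.
  have mCs i l : measurable (Cs i l).
    by rewrite /Cs; case: eqP => // _; exact: mBs.
  have -> : [set w | forall i, Bs i (X i w)] = [set w | forall i l, Cs i l (Q w i l)].
    apply/seteqP; split => w /= Bw i; last by have := Bw i j; rewrite /Cs eqxx.
    by move=> l; rewrite /Cs; case: eqP => // ->; exact: Bw.
  rewrite Qprod//; congr EFin; apply: eq_bigr => i _.
  rewrite (bigD1 j)//= /Cs eqxx big1 ?mulr1; first by rewrite QN//; exact: mBs.
  move=> l /negbTE ->.
  by rewrite (_ : [set w | setT (Q w i l)] = setT) ?probability_setT//; apply/seteqP; split.
have := @normal_combination R _ T P n X mX PX (fun i => x i 0) B mB.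
have -> : Num.sqrt (\sum_i x i 0 ^+ 2) = enorm x.
  by rewrite /enorm /dotv; congr Num.sqrt; apply: eq_bigr => i _; rewrite expr2.
have -> : [set w | B (\sum_i x i 0 * X i w)] =
    [set w | ((Q w)^T *m x) j 0 ^+ 2 < r ^+ 2 * enorm x ^+ 2].
  have ZE w : ((Q w)^T *m x) j 0 = \sum_i x i 0 * X i w.
    by rewrite mxE; apply: eq_bigr => i _; rewrite mxE mulrC.
  by apply/seteqP; split => w; rewrite /= /B /= ZE.
move=> ->; rewrite (_ : [set z | _] = [set z : R | z ^+ 2 < r ^+ 2]).
  exact: normal_small_ball.
have x2 : 0 < enorm x ^+ 2 by rewrite exprn_gt0.
by apply/seteqP; split => z; rewrite /= /B /= exprMn mulrC ltr_pM2r.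
Qed.

Lemma measurable_sketch (x : 'cV[R]_n) :
  measurable_fun [set: T] (fun w => enorm ((Q w)^T *m x) ^+ 2).
Proof.
apply: measurable_funX; apply: measurable_enorm; apply: mxmeas_mul.
  by apply: mxmeas_tr; exact: gaussian_mxmeas.
exact: mxmeas_cst.
Qed.

Let sqr_sketch (x : 'cV[R]_n) w :
  enorm ((Q w)^T *m x) ^+ 2 = \sum_j ((Q w)^T *m x) j 0 ^+ 2.
Proof. by rewrite sqr_enorm; apply: eq_bigr => j _; rewrite expr2. Qed.

(** The 32nd power of 33/32 already exceeds 8/3; the powers are rounded down at
    each squaring. *)
Let expN1 : expR (- 1) <= 3 / 8 :> R.
Proof.
suff e1 : 8 / 3 <= expR 1 :> R.
  have -> : 3 / 8 = (8 / 3)^-1 :> R by rewrite invf_div.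
  by rewrite expRN lef_pV2 ?posrE ?expR_gt0// divr_gt0.
have sq (a b u : R) : 0 <= a -> a <= u -> b <= a ^+ 2 -> b <= u ^+ 2.
  by move=> a0 au /le_trans; apply; rewrite ler_pXn2r ?nnegrE// (le_trans a0).
have -> : expR 1 = ((((expR (32^-1) ^+ 2) ^+ 2) ^+ 2) ^+ 2) ^+ 2 :> R.
  rewrite -!exprM -[(_ * _)%N]/32%N -expRM_natl; congr expR.
  by rewrite mulfV.
apply: (sq (1635 / 1000)); [lra| |lra].
apply: (sq (12787 / 10000)); [lra| |lra].
apply: (sq (11308 / 10000)); [lra| |lra].
apply: (sq (10634 / 10000)); [lra| |lra].
apply: (sq (33 / 32)); [lra| |lra].
by apply: le_trans (expR_ge1Dx _); lra.
Qed.

(** Each entry of Q^T x is Gaussian with deviation |x|. For d = 1 its density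
    bound suffices. For d >= 2, the number of entries below |x| / sqrt 8 has
    mean at most 29/100 d, so by Markov's inequality it reaches d / 2 with
    probability at most 58/100; otherwise the other entries give the bound. *)
Lemma sketch_lower (x : 'cV[R]_n) : (0 < d)%N -> 0 < enorm x ->
  (P [set w | (enorm ((Q w)^T *m x) ^+ 2 < 16^-1 * d%:R * enorm x ^+ 2)%R]
    <= (955 / 1000 - 2 * expR (- d%:R))%:E)%E.
Proof.
move=> d0 x0; have x2 : 0 < enorm x ^+ 2 by rewrite exprn_gt0.
have [d1|d2] := leqP d 1.
  (* The radius 1/4 leaves 82/100 * 1/4 = 205/1000, and 2 / e <= 3/4. *)
  have dE : d = 1%N by apply/eqP; rewrite eqn_leq d1.
  pose j0 := Ordinal d0.
  have -> : [set w | enorm ((Q w)^T *m x) ^+ 2 < 16^-1 * d%:R * enorm x ^+ 2] =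
      [set w | ((Q w)^T *m x) j0 0 ^+ 2 < (4^-1) ^+ 2 * enorm x ^+ 2].
    have c16 : (4^-1) ^+ 2 = 16^-1 * d%:R :> R by rewrite dE mulr1; field.
    rewrite c16; apply/seteqP; split => w /=; rewrite sqr_sketch (bigD1 j0)//=;
    rewrite big1 ?addr0// => j /eqP; case; apply/val_inj => /=;
    by have := ltn_ord j; rewrite [X in (_ < X)%N -> _]dE; case: (nat_of_ord j).
  apply: (le_trans (column_small_ball _ _ _)) => //.
  by rewrite lee_fin dE; have := expN1; lra.
have [r [r0 r2 rle]] : exists r : R, [/\ 0 <= r, r ^+ 2 = 8^-1 & r <= 3536 / 10000].
  exists (Num.sqrt 8^-1).
  have s0 : 0 <= Num.sqrt 8^-1 :> R by exact: sqrtr_ge0.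
  have s2 : Num.sqrt 8^-1 ^+ 2 = 8^-1 :> R by rewrite sqr_sqrtr// invr_ge0.
  split=> //; move: s0 s2; move: (Num.sqrt _) => s s0 s2.
  by rewrite leNgt; apply/negP => h; nra.
pose A j := [set w | ((Q w)^T *m x) j 0 ^+ 2 < r ^+ 2 * enorm x ^+ 2].
set D := [set w | _ < _].
have mA j : measurable (A j).
  apply: measurable_lt; apply: measurable_funX.
  have mm : mxmeas (fun w => (Q w)^T *m x).
    apply: mxmeas_mul; last exact: mxmeas_cst.
    by apply: mxmeas_tr; exact: gaussian_mxmeas.
  exact: mm.
have mD : measurable D by apply: measurable_lt; exact: measurable_sketch.
have count w : D w -> d%:R / 2 <= \sum_(j < d) (\1_(A j) w : R).
  rewrite /D /= sqr_sketch => Dw; rewrite leNgt; apply/negP => few.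
  have : \sum_(j < d) (1 - \1_(A j) w) * (r ^+ 2 * enorm x ^+ 2) <=
         \sum_j ((Q w)^T *m x) j 0 ^+ 2.
    apply: ler_sum => j _; rewrite indicE; case: (boolP (w \in A j)) => jA.
      by rewrite subrr mul0r sqr_ge0.
    rewrite subr0 mul1r leNgt; apply/negP => h; move/negP: jA; apply.
    exact/mem_set.
  rewrite -mulr_suml sumrB sumr_const card_ord r2.
  move: few Dw; set U := \sum_(j < d) \1_(A j) w; set V := \sum_j ((Q w)^T *m x) j 0 ^+ 2.
  move: x2; move: (enorm x ^+ 2) => e e0 h1 h2 h3.
  have : 8^-1 * ((d%:R - U) - d%:R / 2) * e < 0 by nra.
  by rewrite pmulr_llt0// pmulr_rlt0//; lra.
have d2p : 0 < d%:R / 2 :> R by rewrite divr_gt0// ltr0n.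
have markov : ((d%:R / 2)%:E * P D <= \sum_(j < d) P (A j))%E.
  have -> : ((d%:R / 2)%:E * P D = \int[P]_w ((d%:R / 2)%:E * (\1_D w)%:E))%E.
    by rewrite ge0_integralZl ?integral_indic ?setIT//; apply/measurable_EFinP; exact: measurable_indic.
  have -> : (\sum_(j < d) P (A j) = \int[P]_w \sum_(j < d) (\1_(A j) w)%:E)%E.
    rewrite ge0_integral_sum//; last first.
      by move=> j; apply/measurable_EFinP; exact: measurable_indic.
    by apply: eq_bigr => j _; rewrite integral_indic ?setIT.
  apply: ge0_le_integral => //.
  - by apply/measurable_EFinP; apply: measurable_funM => //; exact: measurable_indic.
  - by apply: emeasurable_sum => j; apply/measurable_EFinP; exact: measurable_indic.
  - move=> w _; rewrite sumEFin -EFinM lee_fin indicE; case: (boolP (w \in D)) => [|_].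
      by rewrite inE mulr1 => /count.
    by rewrite mulr0 sumr_ge0.
have : ((d%:R / 2)%:E * P D <= (d%:R * (29 / 100))%:E)%E.
  apply: (le_trans markov).
  apply: (@le_trans _ _ (\sum_(j < d) (29 / 100)%:E)%E).
    apply: lee_sum => j _; apply: (le_trans (column_small_ball j r0 x0)).
    by rewrite lee_fin; lra.
  rewrite sumEFin sumr_const card_ord lee_fin -[leLHS]mulr_natl. exact: lexx.
have Pfin : P D \is a fin_num by exact: fin_num_measure.
rewrite -(fineK Pfin) -EFinM !lee_fin => PD.
have dp : 0 < d%:R :> R by rewrite ltr0n.
have PD' : fine (P D) <= 58 / 100.
  rewrite -(ler_pM2l dp); move: PD; move: (fine _) => p; lra.
have e2 : expR (- d%:R) <= (3 / 8) ^+ 2 :> R.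
  apply: (@le_trans _ _ (expR (- 2))); first by rewrite ler_expR lerN2 ler_nat.
  have -> : - 2 = 2%:R * - 1 :> R by rewrite mulrN mulr1.
  by rewrite expRM_natl ler_pXn2r ?nnegrE ?expR_ge0// ?expN1// divr_ge0.
by move: e2 PD'; lra.
Qed.

End sketch.

(** * The good event of a sketch *)

Section lipschitz_mx.
Context {R : realType}.

(** One-sided because exchanging M and N gives the other side. *)
Lemma lipschitz_continuous_mx a b (phi : 'M[R]_(a, b) -> R) :
  (forall M N, phi M - phi N <= \sum_i \sum_j `|M i j - N i j|) ->
  continuous (phi : 'M[R]_(a, b) -> R^o).
Proof.
move=> lip M; apply/(@cvgrPdist_le _ R^o _ (nbhs M) (nbhs_filter M)) => e e0.
have ab0 : 0 < (a * b).+1%:R :> R by [].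
have e1 : 0 < e / (a * b).+1%:R by rewrite divr_gt0.
apply/nbhs_ballP; exists (e / (a * b).+1%:R) => // N [_ MN] /=.
have lip2 : \sum_i \sum_j `|M i j - N i j| <= e.
  apply: (@le_trans _ _ (\sum_(i < a) \sum_(j < b) (e / (a * b).+1%:R))).
    by apply: ler_sum => i _; apply: ler_sum => j _; apply: ltW; exact: MN.
  rewrite !sumr_const !card_ord -mulrnA -[leLHS]mulr_natr [leLHS]mulrAC ler_pdivrMr//.
  by rewrite ler_pM2l// ler_nat mulnC.
rewrite ler_norml (le_trans (lip _ _) lip2) andbT lerNl opprB.
apply: le_trans (lip _ _) _; apply: le_trans lip2; rewrite le_eqVlt; apply/orP; left.
by apply/eqP; apply: eq_bigr => i _; apply: eq_bigr => j _; rewrite distrC.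
Qed.

Lemma enorm_mul_entries n r (A : 'M[R]_(n, r)) (v : 'cV[R]_r) : enorm v <= 1 ->
  enorm (A *m v) <= \sum_i \sum_j `|A i j|.
Proof.
move=> v1; have norm1 (u : 'cV[R]_n) : enorm u <= \sum_i `|u i 0|.
  have {1}-> : u = \sum_i u i 0 *: delta_mx i 0.
    apply/colP => i; rewrite summxE (bigD1 i)//= !mxE !eqxx mulr1.
    by rewrite big1 ?addr0// => j ji; rewrite !mxE eq_sym (negbTE ji) mulr0.
  apply: (big_ind2 (fun (x : 'cV_n) y => enorm x <= y)).
  - by rewrite enorm0.
  - by move=> x a y b xa yb; rewrite (le_trans (enormD _ _))// lerD.
  - move=> i _; rewrite enormZ ler_piMr// /enorm /dotv (bigD1 i)//= big1 ?addr0.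
      by rewrite !mxE !eqxx mulr1 sqrtr1.
    by move=> j ji; rewrite !mxE (negbTE ji) mulr0.
apply: le_trans (norm1 _) _; apply: ler_sum => i _; rewrite mxE.
apply: le_trans (ler_norm_sum _ _ _) _; apply: ler_sum => j _.
by rewrite normrM ler_piMr// (le_trans (coord_le_enorm _ _)).
Qed.

Lemma opnorm_continuous n r : continuous (@opnorm R n r : 'M[R]_(n, r) -> R^o).
Proof.
apply: lipschitz_continuous_mx => M N; rewrite lerBlDr; apply: ge_sup.
  by exists (enorm (M *m 0)); exists 0; rewrite //= enorm0.
move=> _ [v /= v1 <-].
have -> : M *m v = (M - N) *m v + N *m v by rewrite -mulmxDl subrK.
apply: le_trans (enormD _ _) _; rewrite lerD//.
  apply: le_trans (enorm_mul_entries _ v1) _.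
  rewrite le_eqVlt; apply/orP; left.
  by apply/eqP; apply: eq_bigr => i _; apply: eq_bigr => j _; rewrite !mxE.
apply: ub_le_sup; last by exists v.
by exists (\sum_i \sum_j `|N i j|) => _ [w /= w1 <-]; exact: enorm_mul_entries.
Qed.

End lipschitz_mx.

Section good_event.
Context {R : realType} disp (T : measurableType disp) (P : probability T R).
Variables (n d : nat) (Q : T -> 'M[R]_(n, d)).
Hypothesis gQ : gaussian_matrix P Q.
Hypothesis d_gt0 : (0 < d)%N.
Hypothesis n_gt0 : (0 < n)%N.
Variables C0 C eps : R.
Hypothesis C_gt0 : 0 < C.
Hypothesis C0C : gaussian_constants n d C0 C.
Hypothesis eps01 : 0 < eps < 1.
Hypothesis p_gt0 : 0 < good_prob d C0 eps.

(** The event on which a sketch Q makes an iteration with gradient x succeed: x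
    is not nearly annihilated by Q^T, and Q does not stretch too much. *)
Definition good_set (th : R) (x : 'cV[R]_n) : set T :=
  [set w | th * d%:R * enorm x ^+ 2 <= enorm ((Q w)^T *m x) ^+ 2] `&`
  [set w | opnorm (Q w *m (Q w)^T) <= C * n%:R].

Let tau := d%:R / (C * n%:R).
Let p := good_prob d C0 eps.
Let O := [set w | opnorm (Q w *m (Q w)^T) <= C * n%:R].

Let dp : 0 < d%:R :> R. Proof. by rewrite ltr0n. Qed.
Let Cnp : 0 < C * n%:R. Proof. by rewrite mulr_gt0// ltr0n. Qed.
Let taup : 0 < tau. Proof. exact: divr_gt0. Qed.

Let mO : measurable O.
Proof.
apply: measurable_le; apply: measurable_continuous_mx; last exact: opnorm_continuous.
by apply: mxmeas_mul; [|apply: mxmeas_tr]; exact: (gaussian_mxmeas gQ).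
Qed.

Let mlow th x : measurable [set w | th * d%:R * enorm x ^+ 2 <= enorm ((Q w)^T *m x) ^+ 2].
Proof.
rewrite (_ : [set w | _] = ~` [set w | enorm ((Q w)^T *m x) ^+ 2 < th * d%:R * enorm x ^+ 2]).
  by apply: measurableC; apply: measurable_lt; exact: (measurable_sketch gQ).
by apply/seteqP; split => w /=; [move=> h; apply/negP; rewrite -leNgt|move/negP; rewrite -leNgt].
Qed.

Lemma measurable_good_set th x : measurable (good_set th x).
Proof. exact: measurableI. Qed.

Let PO : ((1 - 2 * expR (- d%:R))%:E <= P O)%E.
Proof.
have [_] := C0C gQ; congr (_ <= P _)%E.
have E : C * (n%:R / d%:R) = d%:R^-1 * (C * n%:R) by ring.
by apply/seteqP; split => w /=; rewrite E ler_pM2l ?invr_gt0.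
Qed.

Let inter_prob (A B : set T) (a b : R) : measurable A -> measurable B ->
  ((1 - a)%:E <= P A)%E -> ((1 - b)%:E <= P B)%E ->
  ((1 - (a + b))%:E <= P (A `&` B))%E.
Proof.
move=> mA mB; have fA := fin_num_measure P _ mA; have fB := fin_num_measure P _ mB.
have mAB : measurable (A `&` B) by exact: measurableI.
have mAD : measurable (A `\` B) by exact: measurableD.
have fAB := fin_num_measure P _ mAB; have fAD := fin_num_measure P _ mAD.
have disj : (P B + P (A `\` B) <= 1)%E.
  rewrite -measureU//; first by apply: probability_le1; exact: measurableU.
  by apply/seteqP; split => // w [Bw [_]].
have split_ : (P A = P (A `&` B) + P (A `\` B))%E.
  rewrite -measureU//; first by rewrite setUIDK.
  by apply/seteqP; split => // w [[_ Bw] [_]].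
move: split_ disj; rewrite -(fineK fA) -(fineK fB) -(fineK fAB) -(fineK fAD).
rewrite -!EFinD !lee_fin => -[]; lra.
Qed.

Lemma good_set_jl x : (p%:E <= P (good_set (1 - eps) x))%E.
Proof.
have [/(_ eps x eps01) + _] := C0C gQ => E1.
have {E1} PL : ((1 - 2 * expR (- (C0 * eps ^+ 2 * d%:R)))%:E <=
    P [set w | ((1 - eps) * d%:R * enorm x ^+ 2 <= enorm ((Q w)^T *m x) ^+ 2)%R])%E.
  apply: (le_trans E1); apply: le_measure.
  - rewrite inE.
    have mu : measurable_fun [set: T] (fun w => enorm ((Num.sqrt d%:R)^-1 *: ((Q w)^T *m x)) ^+ 2).
      apply: measurable_funX; apply: measurable_enorm; apply: mxmeasZ => //.
      by apply: mxmeas_mul; [apply: mxmeas_tr; exact: (gaussian_mxmeas gQ)|exact: mxmeas_cst].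
    rewrite (_ : [set w | _] =
      (~` [set w | enorm ((Num.sqrt d%:R)^-1 *: ((Q w)^T *m x)) ^+ 2 < (1 - eps) * enorm x ^+ 2])
      `&` [set w | enorm ((Num.sqrt d%:R)^-1 *: ((Q w)^T *m x)) ^+ 2 <= (1 + eps) * enorm x ^+ 2]).
      by apply: measurableI; [apply: measurableC; exact: measurable_lt|exact: measurable_le].
    apply/seteqP; split => w /=.
      by case/andP=> h1 h2; split => //; apply/negP; rewrite -leNgt.
    by move=> [/negP + ->]; rewrite -leNgt => ->.
  - by rewrite inE.
  - move=> w /= /andP[+ _]; rewrite enormZ exprMn normfV ger0_norm ?sqrtr_ge0//.
    by rewrite exprVn (sqr_sqrtr (ltW dp)) ler_pdivlMl// mulrA (mulrC d%:R).
exact: (inter_prob (mlow _ _) mO PL PO).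
Qed.

Let nonempty_of (A : set T) (q : R) : 0 < q -> (q%:E <= P A)%E -> A !=set0.
Proof.
move=> q0 qA; apply/set0P/eqP => A0; move: qA; rewrite A0 measure0 lee_fin.
by rewrite leNgt q0.
Qed.

Lemma eps_tau_le1 (x : 'cV[R]_n) : 0 < enorm x -> (1 - eps) * tau <= 1.
Proof.
move=> x0; have [w [/= low op]] := nonempty_of p_gt0 (good_set_jl x).
have x2 : 0 < enorm x ^+ 2 by rewrite exprn_gt0.
rewrite /tau mulrA ler_pdivrMr// mul1r -(ler_pM2r x2).
exact: le_trans low (enorm_trmul_le _ op).
Qed.

(** If C n were below d / 16, the event of (ii) would be contained in the small
    ball event of sketch_lower, whose probability is smaller. *)
Lemma tau_le16 (x : 'cV[R]_n) : 0 < enorm x -> tau <= 16.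
Proof.
move=> x0; rewrite leNgt; apply/negP; rewrite /tau ltr_pdivlMr// => h.
have x2 : 0 < enorm x ^+ 2 by rewrite exprn_gt0.
have sub : (P O <= (955 / 1000 - 2 * expR (- d%:R))%:E)%E.
  apply: le_trans (sketch_lower gQ d_gt0 x0); apply: le_measure.
  - by rewrite inE.
  - by rewrite inE; apply: measurable_lt; exact: (measurable_sketch gQ).
  move=> w /= Ow; apply: le_lt_trans (enorm_trmul_le _ Ow) _.
  by rewrite ltr_pM2r// ltr_pdivlMl.
by have := le_trans PO sub; rewrite lee_fin; lra.
Qed.

Let p_le1 : p <= 1.
Proof.
rewrite /p /good_prob; have := expR_ge0 (- (C0 * eps ^+ 2 * d%:R)).
by have := expR_ge0 (- d%:R : R); lra.
Qed.

(** If 1 - eps is at least tau / 696, the isometry bound (i) gives th = 1 - eps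
    and q = p. Otherwise this threshold is too small for run_gain, and the small
    ball estimate takes over with th = tau / 696 <= 1/16 and q = 45/1000, a
    threshold and a probability that do not depend on eps. The comparison with
    p (1 - eps)^2 tau / 9 then holds because (1 - eps)^2 <= (16 / 696)^2. *)
Lemma good_set_prob : exists th q : R, [/\ 1 - eps <= th, tau <= 696 * th,
  p * (1 - eps) ^+ 2 * tau / 9 <= q * th, 0 <= q &
  forall x, 0 < enorm x -> (q%:E <= P (good_set th x))%E].
Proof.
have [x0 x0p] : exists x : 'cV[R]_n, 0 < enorm x.
  exists (const_mx 1); rewrite lt0r enorm_ge0 andbT enorm_eq0; apply/negP => /eqP/colP.
  by move=> /(_ (Ordinal n_gt0)) /eqP; rewrite !mxE oner_eq0.
have del : 0 < 1 - eps by case/andP: eps01; lra.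
have t16 := tau_le16 x0p; have t1 := eps_tau_le1 x0p.
have [small|large] := leP tau (696 * (1 - eps)).
  exists (1 - eps), p; split=> //; [|exact: ltW|by move=> x _; exact: good_set_jl].
  have -> : p * (1 - eps) ^+ 2 * tau / 9 = p * (1 - eps) * ((1 - eps) * tau / 9) by field.
  by rewrite ler_piMr ?mulr_ge0 ?(ltW p_gt0) ?(ltW del)//; lra.
exists (tau / 696), (45 / 1000); split; [lra|lra| |lra|].
  have p0 := ltW p_gt0; rewrite -/p in p0.
  have sqle (a b : R) : 0 <= a -> a <= b -> a ^+ 2 <= b ^+ 2.
    by move=> a0 ab; rewrite ler_pXn2r ?nnegrE// (le_trans a0).
  have h1 : (1 - eps) ^+ 2 <= (tau / 696) ^+ 2 by apply: sqle; lra.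
  have h2 : (tau / 696) ^+ 2 <= (16 / 696) ^+ 2.
    by apply: sqle; move: taup; lra.
  have h3 : p * (1 - eps) ^+ 2 <= (16 / 696) ^+ 2.
    by apply: le_trans (le_trans h1 h2); rewrite ler_piMl ?sqr_ge0.
  have h4 : p * (1 - eps) ^+ 2 * tau <= (16 / 696) ^+ 2 * tau by rewrite ler_pM2r.
  by move: h4 taup; lra.
move=> x xp; set D := [set w | enorm ((Q w)^T *m x) ^+ 2 < 16^-1 * d%:R * enorm x ^+ 2].
have mD : measurable D by apply: measurable_lt; exact: (measurable_sketch gQ).
have fD := fin_num_measure P _ mD.
have PDC : ((1 - (955 / 1000 - 2 * expR (- d%:R)))%:E <= P (~` D))%E.
  rewrite probability_setC//; have := sketch_lower gQ d_gt0 xp; rewrite -/D.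
  by rewrite -(fineK fD) -EFinB !lee_fin => h; rewrite lerD2l lerN2.
have := inter_prob (measurableC mD) mO PDC PO => h.
apply: (@le_trans _ _ (P (~` D `&` O))).
  by apply: le_trans h; rewrite lee_fin; lra.
apply: le_measure.
- by rewrite inE; apply: measurableI => //; exact: measurableC.
- by rewrite inE; exact: measurable_good_set.
move=> w [/negP + Ow]; rewrite -leNgt => low; split=> //=.
apply: le_trans low; rewrite ler_pM2r ?exprn_gt0// ler_pM2r//; lra.
Qed.

End good_event.

(** * Fubini for independent sigma-algebras *)

Section independent_fubini.
Context {R : realType} disp (T : measurableType disp) (P : probability T R).
Variables G1 G2 : set (set T).
Hypothesis mG1 : <<s G1 >> `<=` measurable.
Hypothesis mG2 : <<s G2 >> `<=` measurable.
Hypothesis indep : forall A B, <<s G1 >> A -> <<s G2 >> B ->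
  P (A `&` B) = (P A * P B)%E.

Let T1 := g_sigma_algebraType G1.
Let T2 := g_sigma_algebraType G2.

Let to1 : T -> T1 := id.
Let to2 : T -> T2 := id.

Let mto1 : measurable_fun [set: T] to1.
Proof. by move=> _ Y mY; rewrite setTI; exact: mG1. Qed.

Let mto2 : measurable_fun [set: T] to2.
Proof. by move=> _ Y mY; rewrite setTI; exact: mG2. Qed.

Let f1_mixin := isMeasurableFun.Build _ _ _ _ _ mto1.
Let f1 : {mfun T >-> T1} := HB.pack to1 f1_mixin.
Let f2_mixin := isMeasurableFun.Build _ _ _ _ _ mto2.
Let f2 : {mfun T >-> T2} := HB.pack to2 f2_mixin.

Let P1 : probability T1 R := distribution P f1.
Let P2 : probability T2 R := distribution P f2.

Let diag (w : T) : T1 * T2 := (w, w).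

Let mdiag : measurable_fun [set: T] diag.
Proof. by apply: measurable_fun_pair; [exact: mto1|exact: mto2]. Qed.

Let section_integral (F : T1 * T2 -> \bar R) w : measurable_fun setT F ->
  (forall z, (0 <= F z)%E) ->
  fubini_F P2 F w = (\int[P]_w2 F (w, w2 : T2))%E.
Proof.
move=> mF F0; rewrite /fubini_F ge0_integral_pushforward//.
exact: (measurableT_comp mF (measurable_pair1 _)).
Qed.

Lemma measurable_section_integral (F : T1 * T2 -> \bar R) :
  measurable_fun setT F -> (forall z, (0 <= F z)%E) ->
  measurable_fun [set: T] (fun w1 : T => \int[P]_w2 F (w1 : T1, w2 : T2))%E.
Proof.
move=> mF F0; rewrite (_ : (fun _ => _) = fubini_F P2 F \o to1).
  apply: measurableT_comp mto1.
  exact: (measurable_fun_fubini_tonelli_F (m2 := P2) _ mF F0).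
by apply/funext => w /=; rewrite section_integral.
Qed.

(** Independence says that the diagonal pushes P to the product of its
    restrictions to the two sigma-algebras: both measures agree on rectangles.
    Working with sigma-algebras on T itself avoids choosing a measurable space
    in which the random matrices take their values. *)
Lemma indep_fubini (F : T1 * T2 -> \bar R) : measurable_fun setT F ->
  (forall z, (0 <= F z)%E) ->
  (\int[P]_w F (w : T1, w : T2) =
   \int[P]_w1 \int[P]_w2 F (w1 : T1, w2 : T2))%E.
Proof.
move=> mF F0.
pose m_ : {measure set (T1 * T2) -> \bar R} := pushforward P diag.
transitivity (\int[m_ mdiag]_z F z)%E.
  by rewrite /m_ ge0_integral_pushforward.
transitivity (\int[P1 \x P2]_z F z)%E.
  apply: eq_measure_integral => A mA _; apply/esym/product_measure_unique => //.
rewrite (fubini_tonelli1 F mF F0).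
rewrite [LHS]ge0_integral_pushforward//; first last.
- by move=> w _; apply: integral_ge0.
- exact: (measurable_fun_fubini_tonelli_F (m2 := P2) _ mF F0).
by apply: eq_integral => w _; exact: section_integral.
Qed.

End independent_fubini.

(** * A continuous extension of spectral clipping *)

Section clip_extension.
Context {R : realType}.

Let dist1 n (M N : 'M[R]_n) : R := \sum_i \sum_j `|M i j - N i j|.

Let dist1_triangle n (M N K : 'M[R]_n) : dist1 M K <= dist1 M N + dist1 N K.
Proof.
rewrite /dist1 -big_split ler_sum// => i _; rewrite -big_split ler_sum// => j _.
by rewrite -(subrKA (N i j)) ler_normD.
Qed.

Let clip_dist1 n (M1 M2 : R) (A B A' B' : 'M[R]_n) i j :
  eig_clip M1 M2 A B -> eig_clip M1 M2 A' B' -> B i j - B' i j <= dist1 A A'.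
Proof.
move=> AB AB'; apply: le_trans (ler_norm _) _.
have d0 : 0 <= dist1 A A' by do 2 apply: sumr_ge0 => ? _.
rewrite -(@ler_pXn2r _ 2) ?nnegrE// real_normK ?num_real//.
apply: (@le_trans _ _ (\sum_k \sum_l (B - B') k l ^+ 2)).
  rewrite (bigD1 i)//= (bigD1 j)//= !mxE -addrA lerDl addr_ge0//.
    by apply: sumr_ge0 => l _; rewrite sqr_ge0.
  by do 2 apply: sumr_ge0 => ? _; rewrite sqr_ge0.
apply: le_trans (eig_clip_lipschitz AB AB') _.
rewrite expr2 {1}/dist1 mulr_suml; apply: ler_sum => k _.
rewrite mulr_suml; apply: ler_sum => l _.
rewrite -real_normK ?num_real// expr2 !mxE ler_wpM2l//.
rewrite /dist1 (bigD1 k)//= (bigD1 l)//= -addrA lerDl addr_ge0//.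
  by apply: sumr_ge0.
by do 2 apply: sumr_ge0 => ? _.
Qed.

(** Clipping the spectrum is nonexpansive where it is defined, so each entry has
   an inf-convolution (McShane) extension to all matrices. This makes the
   clipped matrix measurable without measurable eigenvectors. *)
Lemma eig_clip_continuous n (M1 M2 : R) (i j : 'I_n) :
  exists2 phi : 'M[R]_n -> R, continuous (phi : 'M[R]_n -> R^o) &
    forall A B, eig_clip M1 M2 A B -> B i j = phi A.
Proof.
pose E (M : 'M[R]_n) := [set t | exists A B, eig_clip M1 M2 A B /\ t = B i j + dist1 M A].
have [A0 [B0 AB0]] : exists A0 B0 : 'M[R]_n, eig_clip M1 M2 A0 B0.
  exists (1%:M *m diag_mx 0 *m 1%:M^T).
  exists (1%:M *m diag_mx (map_mx (fun t => Num.max M1 (Num.min M2 t)) 0) *m 1%:M^T).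
  by exists 1%:M, 0; split=> //; rewrite trmx1 mul1mx.
have E0 M : E M !=set0 by exists (B0 i j + dist1 M A0); exists A0, B0.
have Elb M : has_lbound (E M).
  exists (B0 i j - dist1 A0 M) => _ [A [B [AB ->]]].
  have := clip_dist1 i j AB0 AB; have := dist1_triangle A0 M A; lra.
exists (fun M => inf (E M)).
  apply: lipschitz_continuous_mx => M N; rewrite lerBlDr -lerBlDl.
  apply: lb_le_inf => // _ [A [B [AB ->]]].
  rewrite lerBlDl; apply: (@le_trans _ _ (B i j + dist1 M A)).
    by apply: ge_inf => //; exists A, B.
  by have := dist1_triangle M N A; rewrite -/(dist1 M N); lra.
move=> A B AB; apply/eqP; rewrite eq_le; apply/andP; split.
  apply: lb_le_inf => // _ [A' [B' [AB' ->]]].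
  by have := clip_dist1 i j AB AB'; lra.
apply: ge_inf => //; exists A, B; split=> //.
rewrite /dist1 big1 ?addr0// => k _; rewrite big1// => l _.
by rewrite subrr normr0.
Qed.

End clip_extension.

Section sigma.
Context {R : realType} disp (T : measurableType disp) (n d : nat).
Variable Q : nat -> T -> 'M[R]_(n, d).

Definition sketch_gen (J : set nat) : set (set T) :=
  [set A | exists j (i : 'I_n) (l : 'I_d) (B : set R),
        [/\ J j, measurable B & A = [set w | B (Q j w i l)]]].

(** T with the sigma-algebra generated by the sketches of index in J, so that
    being determined by these sketches is measurability on this type. *)
Definition sigmaT (J : set nat) := g_sigma_algebraType (sketch_gen J).

Lemma mxmeas_sketch (J : set nat) k : J k ->
  mxmeas (Q k : sigmaT J -> 'M[R]_(n, d)).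
Proof.
move=> Jk i j _ Y mY; rewrite setTI; apply: sub_sigma_algebra.
by exists k, i, j, Y.
Qed.

Lemma mxmeas_mono (J J' : set nat) a b (F : T -> 'M[R]_(a, b)) : J `<=` J' ->
  mxmeas (F : sigmaT J -> 'M[R]_(a, b)) -> mxmeas (F : sigmaT J' -> 'M[R]_(a, b)).
Proof.
move=> JJ' mF i j _ Y mY; have := mF i j measurableT Y mY.
rewrite !setTI; apply: (smallest_sub (@smallest_sigma_algebra _ _ _)).
move=> A [k [i' [l [B [Jk mB ->]]]]]; apply: sub_sigma_algebra.
by exists k, i', l, B; split=> //; exact: JJ'.
Qed.

End sigma.

(** * The iterates as functions of the past sketches *)

Section run_measurability.
Context {R : realType} disp (T : measurableType disp).
Variables (n m : nat) (f : 'cV[R]_n -> R).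
Hypothesis f_cont : continuous (f : 'cV[R]_n -> R^o).

Lemma measurable_f (x : T -> 'cV[R]_n) : mxmeas x ->
  measurable_fun [set: T] (fun w => f (x w)).
Proof. by move=> mx; exact: measurable_continuous_mx. Qed.

Lemma mxmeas_fd_grad (h : R) r (A : T -> 'M[R]_(n, r)) (x : T -> 'cV[R]_n) :
  mxmeas A -> mxmeas x -> mxmeas (fun w => fd_grad h f (A w) (x w)).
Proof.
move=> mA mx i j; under eq_fun do rewrite mxE.
have mcol : mxmeas (fun w => col i (A w)).
  by move=> a b; under eq_fun do rewrite mxE; exact: mA.
apply: measurable_funM => //; apply: measurable_funB; apply: measurable_f.
  by apply: mxmeasD => //; exact: mxmeasZ.
by apply: mxmeasD => //; apply: mxmeasN; exact: mxmeasZ.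
Qed.

Lemma mxmeas_push_cols (A : T -> 'M[R]_(n, m)) (u v : T -> 'cV[R]_n) :
  mxmeas A -> mxmeas u -> mxmeas v ->
  mxmeas (fun w => push_cols (A w) (u w) (v w)).
Proof.
move=> mA mu mv i j; under eq_fun do rewrite mxE.
by case: (insub j.+2 : option 'I_m) => [j'|]; [exact: mA|case: (j.+2 == m); [exact: mu|exact: mv]].
Qed.

Lemma mxmeas_fd_dir (h : R) (A : T -> 'M[R]_(n, m)) H x :
  mxmeas A -> mxmeas H -> mxmeas x -> mxmeas (fun w => fd_dir f h (A w) (H w) (x w)).
Proof.
move=> mA mH mx; apply: mxmeasN; apply: mxmeas_mul => //.
exact: mxmeas_fd_grad.
Qed.

Lemma measurable_armijo (c h a : R) (A : T -> 'M[R]_(n, m)) x dir :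
  mxmeas A -> mxmeas x -> mxmeas dir ->
  measurable_fun [set: T] (fun w => armijo f c h (A w) (x w) (dir w) a).
Proof.
move=> mA mx md; apply: measurable_fun_ler.
  apply: measurable_f; apply: mxmeasD => //; apply: mxmeasZ => //.
  exact: mxmeas_mul.
apply: measurable_funD; first exact: measurable_f.
apply: measurable_funM => //; apply: measurable_dotv => //.
exact: mxmeas_fd_grad.
Qed.

(** The set where the step is beta ^ i is the set where the Armijo test holds at
    i and fails before. *)
Lemma measurable_line_search (beta c h : R) (A : T -> 'M[R]_(n, m)) x dir a :
  mxmeas A -> mxmeas x -> mxmeas dir ->
  (forall w, line_search f beta c h (A w) (x w) (dir w) (a w)) ->
  measurable_fun [set: T] a.
Proof.
move=> mA mx md ls _ Y mY; rewrite setTI.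
pose ok i := [set w | armijo f c h (A w) (x w) (dir w) (beta ^+ i)].
have mok i : measurable (ok i).
  rewrite (_ : ok i = (fun w => armijo f c h (A w) (x w) (dir w) (beta ^+ i)) @^-1` [set true]).
    by rewrite -[X in measurable X]setTI; exact: measurable_armijo.
  by apply/seteqP; split => w.
rewrite (_ : a @^-1` Y = \bigcup_(i in [set i | Y (beta ^+ i)])
    (ok i `&` \bigcap_(j in [set j | (j < i)%N]) ~` ok j)).
  apply: bigcup_measurable => i _; apply: measurableI => //.
  by apply: bigcap_measurableType => j _; exact: measurableC.
apply/seteqP; split => w.
  move=> Yw; have [i [aE oki nok]] := ls w; exists i; first by rewrite /= -aE.
  by split=> // j /= ji; apply/negP; exact: nok.
move=> [i /= Yi [oki nok]]; have [i' [aE oki' nok']] := ls w.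
rewrite /preimage/= aE; suff -> : i' = i by [].
case: (ltngtP i' i) => // h1; first by have := nok _ h1.
by have := nok' _ h1; rewrite oki.
Qed.

Lemma mxmeas_bfgs (s y : T -> 'cV[R]_m) (H : T -> 'M[R]_m) :
  mxmeas s -> mxmeas y -> mxmeas H -> mxmeas (fun w => bfgs (s w) (y w) (H w)).
Proof.
move=> ms my mH; have mi : measurable_fun [set: T] (fun w => (dotv (s w) (y w))^-1).
  by apply: measurable_inv; exact: measurable_dotv.
apply: mxmeasD; last first.
  by apply: mxmeasZ => //; apply: mxmeas_mul => //; exact: mxmeas_tr.
apply: mxmeas_mul; first apply: mxmeas_mul => //.
  apply: mxmeasD; first exact: mxmeas_cst.
  apply: mxmeasN; apply: mxmeasZ => //; apply: mxmeas_mul => //; exact: mxmeas_tr.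
apply: mxmeasD; first exact: mxmeas_cst.
apply: mxmeasN; apply: mxmeasZ => //; apply: mxmeas_mul => //; exact: mxmeas_tr.
Qed.

Lemma mxmeas_update (M1 M2 : R) (s y : T -> 'cV[R]_m) (H G H' : T -> 'M[R]_m) :
  mxmeas s -> mxmeas y -> mxmeas H -> mxmeas G ->
  (forall w, if dotv (s w) (y w) == 0 then H' w = G w
             else eig_clip M1 M2 (bfgs (s w) (y w) (H w)) (H' w)) ->
  mxmeas H'.
Proof.
move=> ms my mH mG H'E i j.
have [phi phic phiE] := eig_clip_continuous M1 M2 i j.
rewrite (_ : (fun w => H' w i j) = (fun w => if dotv (s w) (y w) == 0 then G w i j
    else phi (bfgs (s w) (y w) (H w)))).
  apply: measurable_fun_ifT; last 2 first.
  - exact: mG.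
  - by apply: measurable_continuous_mx => //; exact: mxmeas_bfgs.
  by apply: measurable_fun_eqr => //; exact: measurable_dotv.
apply/funext => w; have := H'E w; case: ifP => _; first by move=> ->.
exact: phiE.
Qed.

End run_measurability.

Section run.
Context {R : realType} disp (T : measurableType disp) (P : probability T R).
Variables (n m d : nat) (f : 'cV[R]_n -> R).
Hypothesis f_cont : continuous (f : 'cV[R]_n -> R^o).
Variables (beta c M1 M2 : R) (h : nat -> R) (x0 : 'cV[R]_n) (H0 : 'M[R]_m).
Variable Pinit : 'M[R]_(n, m).
Variables (Q : nat -> T -> 'M[R]_(n, d)) (G : nat -> T -> 'M[R]_m).
Variables (x : nat -> T -> 'cV[R]_n) (A : nat -> T -> 'M[R]_(n, m)).
Variables (H : nat -> T -> 'M[R]_m) (alpha : nat -> T -> R).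
Hypothesis GQ : determined Q G.
Hypothesis run : forall w, fd_run f beta c M1 M2 h x0 H0 Pinit (Q^~ w) (G^~ w)
                    (x^~ w) (A^~ w) (H^~ w) (alpha^~ w).

Notation past k := (sigmaT Q [set j | (j < k)%N]).
Let prev k w := if k is k'.+1 then A k' w else Pinit.

Let mono k a b (F : T -> 'M[R]_(a, b)) :
  mxmeas (F : past k -> 'M[R]_(a, b)) -> mxmeas (F : past k.+1 -> 'M[R]_(a, b)).
Proof. by apply: mxmeas_mono => j /= jk; rewrite (ltn_trans jk). Qed.

Let mA k : mxmeas (prev k : past k -> 'M[R]_(n, m)) ->
  mxmeas (x k : past k -> 'cV[R]_n) -> mxmeas (A k : past k.+1 -> 'M[R]_(n, m)).
Proof.
move=> mp mx.
have -> : A k = fun w => push_cols (prev k w) (normalize (x k w))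
    (normalize (Q k w *m fd_grad (h k) f (Q k w) (x k w))).
  by apply/funext => w; rewrite (run_A (run w) k).
have mQ : mxmeas (Q k : past k.+1 -> 'M[R]_(n, d)) by apply: mxmeas_sketch => /=.
apply: mxmeas_push_cols; first exact: mono.
  by apply: mxmeas_normalize; exact: mono.
apply: mxmeas_normalize; apply: mxmeas_mul => //.
by apply: mxmeas_fd_grad => //; exact: mono.
Qed.

(** The columns kept from the previous iteration are part of the induction, as
    they enter the next matrix together with the fresh sketch. *)
Lemma run_measurable k : [/\ mxmeas (x k : past k -> 'cV[R]_n),
  mxmeas (H k : past k -> 'M[R]_m) & mxmeas (prev k : past k -> 'M[R]_(n, m))].
Proof.
elim: k => [|k [mx mH mp]].
  split.
  - have -> : x 0%N = cst x0 by apply/funext => w; exact: (run_x0 (run w)).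
    exact: mxmeas_cst.
  - have -> : H 0%N = cst H0 by apply/funext => w; exact: (run_H0 (run w)).
    exact: mxmeas_cst.
  - exact: mxmeas_cst.
have mA' := mA mp mx; have mx' := mono mx; have mH' := mono mH.
have md : mxmeas ((fun w => fd_dir f (h k) (A k w) (H k w) (x k w)) : past k.+1 -> 'cV[R]_m).
  exact: mxmeas_fd_dir.
have ma : measurable_fun [set: past k.+1] (alpha k).
  by apply: (measurable_line_search f_cont mA' mx' md) => w; exact: (run_alpha (run w) k).
have mxS : mxmeas (x k.+1 : past k.+1 -> 'cV[R]_n).
  have -> : x k.+1 = fun w => x k w + alpha k w *: (A k w *m fd_dir f (h k) (A k w) (H k w) (x k w)).
    by apply/funext => w; exact: (run_x (run w) k).
  by apply: mxmeasD => //; apply: mxmeasZ => //; exact: mxmeas_mul.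
split=> //; apply: (@mxmeas_update _ _ (past k.+1) m M1 M2
  (fun w => alpha k w *: fd_dir f (h k) (A k w) (H k w) (x k w))
  (fun w => fd_grad (h k) f (A k w) (x k.+1 w) - fd_grad (h k) f (A k w) (x k w))
  (H k) (G k)) => //.
- exact: mxmeasZ.
- by apply: mxmeasD; [|apply: mxmeasN]; exact: mxmeas_fd_grad.
- by move=> i j _ Y mY; rewrite setTI; exact: GQ.
- by move=> w; exact: (run_H (run w) k).
Qed.

Hypothesis M1_le_M2 : M1 <= M2.
Hypothesis H0_bounds : spectral_bounds M1 M2 H0.
Hypothesis G_bounds : forall k w, spectral_bounds M1 M2 (G k w).

Lemma run_spectral k w : spectral_bounds M1 M2 (H k w).
Proof.
case: k => [|k]; first by rewrite (run_H0 (run w)).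
have /= := run_H (run w) k; case: ifP => _; first by move=> ->.
exact: eig_clip_bounds.
Qed.

Hypothesis Pinit_unit : forall j, enorm (col j Pinit) = 1.

Let col_push (B : 'M[R]_(n, m)) u v j : col j (push_cols B u v) =
  if (insub j.+2 : option 'I_m) is Some j' then col j' B
  else if j.+2 == m then u else v.
Proof.
apply/colP => i; rewrite !mxE; case: (insub j.+2 : option 'I_m) => [j'|]; first by rewrite mxE.
by case: ifP.
Qed.

Lemma run_columns k w j : enorm (col j (A k w)) <= 1.
Proof.
elim: k j => [|k IH] j; rewrite (run_A (run w)) col_push; case: (insub j.+2 : option 'I_m) => [j'|].
- by rewrite Pinit_unit.
- by case: ifP => _; exact: normalize_le1.
- exact: IH.
- by case: ifP => _; exact: normalize_le1.
Qed.

Hypothesis m_gt0 : (0 < m)%N.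

Lemma run_last_column : exists j0 : 'I_m, forall k w,
  col j0 (A k w) = normalize (Q k w *m fd_grad (h k) f (Q k w) (x k w)).
Proof.
have lt : (m.-1 < m)%N by rewrite prednK.
exists (Ordinal lt) => k w; rewrite (run_A (run w)) col_push /= insubF; last first.
  by rewrite prednK// ltnNge leqnSn.
by rewrite prednK// gtn_eqF.
Qed.

End run.

(** * A fresh sketch is independent of the past *)

Section base_measurability.
Context {R : realType} disp (T : measurableType disp) (P : probability T R).
Variables (n d : nat) (Q : nat -> T -> 'M[R]_(n, d)).
Hypothesis gQ : forall k, gaussian_matrix P (Q k).

Lemma sketch_sigma_measurable (J : set nat) : <<s sketch_gen Q J >> `<=` measurable.
Proof.
apply: (smallest_sub (@sigma_algebra_measurable _ T)) => _ [j [i [l [B [_ mB ->]]]]].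
by rewrite -[X in measurable X]setTI; exact: (gaussian_mxmeas (gQ j)).
Qed.

Lemma mxmeas_base (J : set nat) a b (F : T -> 'M[R]_(a, b)) :
  mxmeas (F : sigmaT Q J -> 'M[R]_(a, b)) -> mxmeas F.
Proof.
move=> mF i j _ Y mY; apply: (@sketch_sigma_measurable J).
exact: (mF i j measurableT).
Qed.

End base_measurability.

Section fresh_sketch.
Context {R : realType} disp (T : measurableType disp) (P : probability T R).
Variables (n d : nat) (Q : nat -> T -> 'M[R]_(n, d)).
Hypothesis gQ : gaussian_sequence P Q.
Variable k : nat.
Notation past := (sigmaT Q [set j | (j < k)%N]).
Notation now := (sigmaT Q [set k]).
Variable g : T -> 'cV[R]_n.
Hypothesis mg : mxmeas (g : past -> 'cV[R]_n).
Variables (C th q : R).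
Hypothesis q_ge0 : 0 <= q.
Hypothesis good : forall x, 0 < enorm x -> (q%:E <= P (good_set (Q k) C th x))%E.

(** The sketch of an iteration is independent of the gradient it is applied to,
   so a success probability valid for fixed vectors holds conditionally. *)
Lemma fresh_sketch (phi : T -> R) :
  measurable_fun [set: past] (phi : past -> R) -> (forall w, 0 <= phi w) ->
  (forall w, 0 < phi w -> 0 < enorm (g w)) ->
  measurable_fun [set: T] (fun w => phi w * \1_(good_set (Q k) C th (g w)) w : R) /\
  (q%:E * \int[P]_w (phi w)%:E <=
   \int[P]_w (phi w * \1_(good_set (Q k) C th (g w)) w)%:E)%E.
Proof.
move=> mphi phi0 phig; have [gQk ind] := gQ.
pose F (z : past * now) : \bar R := (phi z.1 * \1_(good_set (Q k) C th (g z.1)) z.2)%:E.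
have F0 z : (0 <= F z)%E by rewrite lee_fin mulr_ge0.
have mg1 : mxmeas ((fun z => g z.1) : past * now -> 'cV[R]_n).
  by move=> i j; exact: (measurableT_comp (mg i j)).
have mQ2 : mxmeas ((fun z => Q k z.2) : past * now -> 'M[R]_(n, d)).
  have mQ : mxmeas (Q k : now -> 'M[R]_(n, d)) by exact: mxmeas_sketch.
  by move=> i j; exact: (measurableT_comp (mQ i j)).
pose E : set (past * now) := [set z | good_set (Q k) C th (g z.1) z.2].
have mE : measurable E.
  have mv : measurable_fun setT (fun z : past * now =>
      th * d%:R * enorm (g z.1) ^+ 2 - enorm ((Q k z.2)^T *m g z.1) ^+ 2).
    apply: measurable_funB.
      by apply: measurable_funM => //; apply: measurable_funX; exact: measurable_enorm.
    apply: measurable_funX; apply: measurable_enorm; apply: mxmeas_mul => //.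
    exact: mxmeas_tr.
  have mo : measurable_fun setT (fun z : past * now => opnorm (Q k z.2 *m (Q k z.2)^T)).
    apply: measurable_continuous_mx; last exact: opnorm_continuous.
    by apply: mxmeas_mul => //; exact: mxmeas_tr.
  rewrite (_ : E = [set z | th * d%:R * enorm (g z.1) ^+ 2 - enorm ((Q k z.2)^T *m g z.1) ^+ 2 <= 0]
      `&` [set z | opnorm (Q k z.2 *m (Q k z.2)^T) <= C * n%:R]).
    by apply: measurableI; exact: measurable_le.
  by apply/seteqP; split => z; rewrite /E /good_set /= subr_le0.
have mF : measurable_fun setT F.
  apply/measurable_EFinP; apply: measurable_funM.
    exact: (measurableT_comp mphi).
  exact: (measurable_indic mE).
have sub_past : <<s sketch_gen Q [set j | (j < k)%N] >> `<=` measurable.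
  exact: sketch_sigma_measurable.
have sub_now : <<s sketch_gen Q [set k] >> `<=` measurable.
  exact: sketch_sigma_measurable.
split.
  apply/measurable_EFinP; apply: (measurableT_comp mF (_ : measurable_fun setT
    (fun w : T => (w, w) : past * now))).
  by apply: measurable_fun_pair => _ Y mY; rewrite setTI; [exact: sub_past|exact: sub_now].
have -> : (\int[P]_w (phi w * \1_(good_set (Q k) C th (g w)) w)%:E = \int[P]_w F (w, w))%E by [].
have mphiT : measurable_fun [set: T] phi.
  by move=> _ Y mY; apply: sub_past; exact: (mphi measurableT).
rewrite (indep_fubini (P := P) sub_past sub_now (ind k) mF F0).
rewrite -ge0_integralZl//; last 2 first.
- by apply/measurable_EFinP.
- by move=> w _; rewrite lee_fin.
apply: ge0_le_integral => //.
- by move=> w _; rewrite mule_ge0// lee_fin.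
- by apply/measurable_EFinP; exact: measurable_funM.
- exact: (measurable_section_integral P sub_past sub_now mF F0).
move=> w _; rewrite /F /=.
under eq_integral do rewrite EFinM.
have mgs : measurable (good_set (Q k) C th (g w)) by exact: (measurable_good_set (gQk k)).
rewrite ge0_integralZl//; last 2 first.
- by apply/measurable_EFinP; exact: measurable_indic.
- by rewrite lee_fin.
rewrite integral_indic// setIT muleC.
have [phi_gt0|] := ltP 0 (phi w).
  by rewrite lee_pmul2l// ?lte_fin//; apply: good; exact: phig.
move=> phi_le0; have -> : phi w = 0 by apply/eqP; rewrite eq_le phi_le0 phi0.
by rewrite !mul0e.
Qed.

End fresh_sketch.

(** * Expected decrease and telescoping *)

Lemma min_grad_ge0 (R : realType) n (f : 'cV[R]_n -> R) (x : nat -> 'cV[R]_n) k :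
  0 <= min_grad f x k.
Proof.
rewrite /min_grad; elim/big_ind: _ => [|y z y0 z0|j _]; rewrite ?enorm_ge0//.
by rewrite le_min y0.
Qed.

Section expected_descent.
Context {R : realType} disp (T : measurableType disp) (P : probability T R).
Variables (n m d : nat).
Hypothesis d_gt0 : (0 < d)%N.
Hypothesis m_ge2 : (1 < m)%N.
Hypothesis n_gt0 : (0 < n)%N.
Variable f : 'cV[R]_n -> R.
Hypothesis f_C2 : classC2 f.
Hypothesis f_bounded : has_lbound (range f).
Variables beta c M1 M2 C0 C L eps : R.
Hypothesis beta01 : 0 < beta < 1.
Hypothesis c_gt0 : 0 < c.
Hypothesis c_lt_half : c < 1 / 2.
Hypothesis M1_gt0 : 0 < M1.
Hypothesis M1_le_M2 : M1 <= M2.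
Hypothesis C_gt0 : 0 < C.
Hypothesis C0C : gaussian_constants n d C0 C.
Hypothesis L_gt0 : 0 < L.
Hypothesis grad_lip : forall u v : 'cV[R]_n,
  enorm (grad f u - grad f v) <= L * enorm (u - v).
Hypothesis eps01 : 0 < eps < 1.
Hypothesis p_gt0 : 0 < good_prob d C0 eps.
Variables (x0 : 'cV[R]_n) (H0 : 'M[R]_m) (Pinit : 'M[R]_(n, m)).
Hypothesis H0_bounds : spectral_bounds M1 M2 H0.
Hypothesis Pinit_unit : forall j, enorm (col j Pinit) = 1.
Variable h : nat -> R.
Hypothesis h_gt0 : forall k, 0 < h k.
Variable x : nat -> T -> 'cV[R]_n.
Hypothesis x_run : fd_iterates P d f beta c M1 M2 h x0 H0 Pinit x.

Let K := Kconst n m d C M1 M2 c L eps.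
Let a := descent_const n m d C0 C M1 M2 beta c L eps.
Let s := c * alpha_bar m beta c M2 L * M1.
Let g k w := grad f (x k w).
Let V k w := enorm (g k w) ^+ 2.
(** The truncation leaves only the points where run_gain applies, and still
    V k <= phi k + K ^+ 2 * h k ^+ 2. *)
Let phi k w := if K * h k < enorm (g k w) then V k w else 0.

Let f_diff x' : differentiable (f : 'cV[R]_n -> R^o) x'.
Proof. by case: f_C2. Qed.

Let f_cont : continuous (f : 'cV[R]_n -> R^o).
Proof. by move=> y; exact: differentiable_continuous. Qed.

Let m_gt0 : (0 < m)%N. Proof. exact: ltnW. Qed.
Let M2_gt0 : 0 < M2. Proof. exact: lt_le_trans M1_le_M2. Qed.

Lemma Kconst_gt0 : 0 < K.
Proof.
rewrite /K /Kconst mulr_gt0// lt_max; apply/orP; left.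
have d0 : 0 < Num.sqrt d%:R :> R by rewrite sqrtr_gt0 ltr0n.
have n0 : 0 < n%:R :> R by rewrite ltr0n.
by rewrite divr_gt0 ?mulr_gt0//; case/andP: eps01; lra.
Qed.

Let s_gt0 : 0 < s.
Proof.
have m0 : 0 < m%:R :> R by rewrite ltr0n.
case/andP: beta01 => b0 _.
rewrite /s /alpha_bar mulr_gt0// mulr_gt0// lt_min ltr01/= divr_gt0 ?mulr_gt0//.
by rewrite subr_gt0 mulrC -ltr_pdivlMr.
Qed.

Let aE : a = s / 4 * (good_prob d C0 eps * (1 - eps) ^+ 2 * (d%:R / (C * n%:R)) / 9)
  * (d%:R / (C * n%:R)).
Proof.
have n0 : n%:R != 0 :> R by rewrite pnatr_eq0 -lt0n.
rewrite /a /descent_const -/s; field.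
by rewrite n0 gt_eqF.
Qed.

Lemma descent_const_gt0 : 0 < a.
Proof.
have n0 : 0 < n%:R :> R by rewrite ltr0n.
have d0 : 0 < d%:R :> R by rewrite ltr0n.
have e0 : 0 < 1 - eps by case/andP: eps01; lra.
have tau0 : 0 < d%:R / (C * n%:R) by rewrite divr_gt0 ?mulr_gt0.
rewrite aE; apply: mulr_gt0 => //; apply: mulr_gt0; apply: divr_gt0 => //.
by rewrite mulr_gt0// mulr_gt0// exprn_gt0.
Qed.

Let grad_meas k J (Q : nat -> T -> 'M[R]_(n, d)) :
  mxmeas (x k : sigmaT Q J -> 'cV[R]_n) -> mxmeas (g k : sigmaT Q J -> 'cV[R]_n).
Proof.
move=> mx i j; rewrite (_ : (fun w => _) = fun w => partial f i (x k w)); last first.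
  by apply/funext => w; rewrite /g /grad mxE.
apply: measurable_continuous_mx => // y; apply: differentiable_continuous.
by case: f_C2 => _ + _; exact.
Qed.

Let phi_ge0 k w : 0 <= phi k w.
Proof. by rewrite /phi; case: ifP => // _; exact: sqr_ge0. Qed.

(** One iteration decreases f on average by a multiple of the squared gradient,
    up to the resolution of the finite differences: run_gain holds on the good
    event, whose conditional probability is bounded below by fresh_sketch, and f
    does not increase elsewhere. *)
Lemma expected_decrease k : [/\ measurable_fun [set: T] (V k),
  measurable_fun [set: T] (phi k),
  measurable_fun [set: T] (fun w => f (x k w)),
  (forall w, f (x k.+1 w) <= f (x k w)) &
  (a%:E * \int[P]_w (phi k w)%:E <= \int[P]_w (f (x k w) - f (x k.+1 w))%:E)%E].
Proof.
have [Q [G [A [H [alpha [gQ GQ GB run]]]]]] := x_run.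
have [gQk _] := gQ.
pose past := sigmaT Q [set j | (j < k)%N].
have [mx _ _] := run_measurable f_cont GQ run k.
have [mxS _ _] := run_measurable f_cont GQ run k.+1.
have mg := grad_meas mx.
have mVp : measurable_fun [set: past] (V k : past -> R).
  by apply: measurable_funX; exact: measurable_enorm.
have mphip : measurable_fun [set: past] (phi k : past -> R).
  apply: measurable_fun_ifT => //.
  by apply: measurable_fun_ltr => //; exact: measurable_enorm.
have base (u : T -> R) : measurable_fun [set: past] (u : past -> R) ->
    measurable_fun [set: T] u.
  by move=> mu _ Y mY; apply: (sketch_sigma_measurable gQk); exact: (mu measurableT).
have mf : measurable_fun [set: T] (fun w => f (x k w)).
  by apply: (measurable_f f_cont); exact: (mxmeas_base gQk mx).
have mfS : measurable_fun [set: T] (fun w => f (x k.+1 w)).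
  by apply: (measurable_f f_cont); exact: (mxmeas_base gQk mxS).
have HM := run_spectral run M1_le_M2 H0_bounds GB k.
have A1 w := run_columns run Pinit_unit k w.
have [j0 Aj0] := run_last_column run m_gt0.
have decr w : f (x k.+1 w) <= f (x k w).
  exact: (run_descent beta01 c_gt0 M1_gt0 (HM w) (run_alpha (run w) k) (run_x (run w) k)).
split=> //; [exact: base|exact: base|].
have [th [q [th_eps th_tau pq q0 good]]] := good_set_prob (gQk k) d_gt0 n_gt0 C_gt0 C0C eps01 p_gt0.
set tau := d%:R / (C * n%:R) in th_tau pq.
have tau_gt0 : 0 < tau by rewrite divr_gt0 ?mulr_gt0 ?ltr0n.
have th_gt0 : 0 < th by apply: lt_le_trans th_eps; case/andP: eps01; lra.
have coef_ge0 : 0 <= s * (th * tau / 4).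
  by rewrite ltW// mulr_gt0// divr_gt0// mulr_gt0.
have phig w : 0 < phi k w -> 0 < enorm (g k w).
  rewrite /phi; case: ifP => [Kg _|_]; last by rewrite ltxx.
  by apply: le_lt_trans Kg; rewrite mulr_ge0// ltW// Kconst_gt0.
have [mfresh fresh] := fresh_sketch gQ mg q0 good mphip (phi_ge0 k) phig.
pose ind w := \1_(good_set (Q k) C th (g k w)) w : R.
have gain w : s * (th * tau / 4) * (phi k w * ind w) <= f (x k w) - f (x k.+1 w).
  rewrite /phi; case: ifP => [Kg|_]; last by rewrite mul0r mulr0 subr_ge0.
  rewrite /ind indicE; case: (boolP (w \in _)) => [|_]; last by rewrite !mulr0 subr_ge0.
  rewrite inE => -[low op]; rewrite mulr1.
  exact: (run_gain f_diff L_gt0 grad_lip d_gt0 n_gt0 m_ge2 beta01 c_gt0 c_lt_half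
    M1_gt0 M1_le_M2 C_gt0 eps01 th_eps th_tau (h_gt0 k) (A1 w) (HM w)
    (run_alpha (run w) k) (run_x (run w) k) (Aj0 k w) Kg low op).
have phiI0 : (0 <= \int[P]_w (phi k w)%:E)%E by apply: integral_ge0 => w _; rewrite lee_fin.
apply: (@le_trans _ _ ((s * (th * tau / 4))%:E * (q%:E * \int[P]_w (phi k w)%:E))%E).
  rewrite muleA -EFinM lee_wpmul2r// lee_fin aE -/tau.
  have -> : s * (th * tau / 4) * q = s / 4 * (q * th) * tau by field.
  by rewrite ler_pM2r// ler_pM2l ?divr_gt0.
apply: (@le_trans _ _ ((s * (th * tau / 4))%:E * \int[P]_w (phi k w * ind w)%:E)%E).
  exact: lee_wpmul2l.
rewrite -ge0_integralZl//; last 2 first.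
- by apply/measurable_EFinP.
- by move=> w _; rewrite lee_fin mulr_ge0.
apply: ge0_le_integral => //.
- by move=> w _; rewrite mule_ge0// lee_fin mulr_ge0.
- by apply/measurable_EFinP; exact: measurable_funM.
- by apply/measurable_EFinP; exact: measurable_funB.
- by move=> w _; rewrite -EFinM lee_fin; exact: gain.
Qed.

Let x_start w : x 0%N w = x0.
Proof. by have [Q [G [A [H [alpha [_ _ _ run]]]]]] := x_run; exact: (run_x0 (run w)). Qed.

Let f_lower y : inf (range f) <= f y.
Proof. by apply: ge_inf => //; exists y. Qed.

(** The decreases telescope. *)
Let phi_sum k : (\int[P]_w (\sum_(j < k.+1) phi j w)%:E
  <= (a^-1 * (f x0 - inf (range f)))%:E)%E.
Proof.
have mphi j : measurable_fun [set: T] (phi j) by have [] := expected_decrease j.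
have mfx j : measurable_fun [set: T] (fun w => f (x j w)) by have [] := expected_decrease j.
have decr j w : f (x j.+1 w) <= f (x j w) by have [_ _ _ +] := expected_decrease j.
have mdiff j : measurable_fun [set: T] (fun w => f (x j w) - f (x j.+1 w)).
  exact: measurable_funB.
rewrite EFinM lee_pdivlMl ?descent_const_gt0//.
under eq_integral do rewrite -sumEFin.
rewrite ge0_integral_sum//; last 2 first.
- by move=> j; apply/measurable_EFinP.
- by move=> j w _; rewrite lee_fin.
rewrite ge0_sume_distrr; last first.
  by move=> j _; apply: integral_ge0 => w _; rewrite lee_fin.
apply: (@le_trans _ _ (\sum_(j < k.+1) \int[P]_w (f (x j w) - f (x j.+1 w))%:E)%E).
  by apply: lee_sum => j _; have [] := expected_decrease j.
rewrite -ge0_integral_sum//; last 2 first.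
- by move=> j; apply/measurable_EFinP.
- by move=> j w _; rewrite lee_fin subr_ge0.
rewrite -[X in (_ <= X)%E]mule1 -(probability_setT P) -integral_cst//.
apply: ge0_le_integral => //.
- by move=> w _; apply: sume_ge0 => j _; rewrite lee_fin subr_ge0.
- by apply: emeasurable_sum => j; apply/measurable_EFinP.
move=> w _; rewrite sumEFin lee_fin.
rewrite -(big_mkord predT (fun j => f (x j w) - f (x j.+1 w))).
have -> : \sum_(0 <= j < k.+1) (f (x j w) - f (x j.+1 w)) = f x0 - f (x k.+1 w).
  rewrite -(x_start w) -[RHS]opprB -(telescope_sumr (fun j => f (x j w)) (leq0n k.+1)).
  by rewrite -sumrN; apply: eq_bigr => j _; rewrite opprB.
by rewrite lerB.
Qed.

Lemma min_grad_measurable k : measurable_fun [set: T] (fun w => min_grad f (x^~ w) k).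
Proof.
have mV j : measurable_fun [set: T] (fun w => enorm (grad f (x j w))).
  rewrite (_ : (fun w => _) = fun w => Num.sqrt (V j w)); last first.
    by apply/funext => w; rewrite /V sqrtr_sqr ger0_norm ?enorm_ge0.
  by apply: measurable_sqrt; have [] := expected_decrease j.
rewrite /min_grad; elim: (index_enum _) => [|j r IH].
  by under eq_fun do rewrite big_nil; exact: mV.
by under eq_fun do rewrite big_cons; exact: measurable_minr.
Qed.

(** For r = sqrt S, any number t satisfies t <= (t^2 + S) / (2 r). Applied to the
    minimum, whose square is at most each squared gradient, this linearizes the
    square root before taking expectations and replaces Jensen's inequality. *)
Lemma mean_min_grad k (S : R) : 0 < S ->
  1 / k.+1%:R * a^-1 * (f x0 - inf (range f))
    + K ^+ 2 * (\sum_(j < k.+1) h j ^+ 2) / k.+1%:R <= S ->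
  ('E_P[fun w => min_grad f (x^~ w) k] <= (Num.sqrt S)%:E)%E.
Proof.
move=> S0 hS; set Delta := f x0 - _ in hS; set hh := \sum_(j < k.+1) _ in hS.
have r0 : 0 < Num.sqrt S by rewrite sqrtr_gt0.
have rS : Num.sqrt S ^+ 2 = S by rewrite sqr_sqrtr// ltW.
set r := Num.sqrt S in r0 rS *.
have k0 : 0 < k.+1%:R :> R by [].
pose c1 := (k.+1%:R * (2 * r))^-1.
have c1_gt0 : 0 < c1 by rewrite invr_gt0 !mulr_gt0.
pose c3 := c1 * (K ^+ 2 * hh) + r / 2.
have c3_ge0 : 0 <= c3.
  have hh0 : 0 <= hh by apply: sumr_ge0 => j _; exact: sqr_ge0.
  apply: addr_ge0; last by rewrite divr_ge0 ?(ltW r0).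
  by apply: mulr_ge0; [exact: ltW|rewrite mulr_ge0 ?sqr_ge0].
pose u w := \sum_(j < k.+1) phi j w.
have u_ge0 w : 0 <= u w by apply: sumr_ge0.
have mu : measurable_fun [set: T] u.
  by apply: measurable_sum => j; have [] := expected_decrease j.
have V_phi j w : V j w <= phi j w + K ^+ 2 * h j ^+ 2.
  rewrite /phi; case: ltP => [_|le]; first by rewrite lerDl mulr_ge0 ?sqr_ge0.
  rewrite add0r -exprMn /V ler_pXn2r ?nnegrE ?enorm_ge0//.
  by rewrite mulr_ge0 ?(ltW Kconst_gt0) ?(ltW (h_gt0 _)).
have mg0 w : 0 <= min_grad f (x^~ w) k by exact: min_grad_ge0.
have mg_le w : min_grad f (x^~ w) k <= c1 * u w + c3.
  set mg := min_grad _ _ _.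
  have sq : k.+1%:R * mg ^+ 2 <= u w + K ^+ 2 * hh.
    rewrite /u /hh mulr_sumr -big_split/= mulr_natl -[X in _ *+ X](card_ord k.+1) -sumr_const.
    apply: ler_sum => j _; apply: le_trans (V_phi j w).
    by rewrite ler_pXn2r ?nnegrE ?enorm_ge0 ?mg0// /mg /min_grad; exact: bigmin_le.
  have rn : r != 0 by rewrite gt_eqF.
  have mgS : mg <= (mg ^+ 2 + S) / (2 * r).
    rewrite ler_pdivlMr ?mulr_gt0// -subr_ge0 -rS.
    have -> : mg ^+ 2 + r ^+ 2 - mg * (2 * r) = (mg - r) ^+ 2 by ring.
    exact: sqr_ge0.
  apply: (le_trans mgS).
  have -> : (mg ^+ 2 + S) / (2 * r) = c1 * (k.+1%:R * mg ^+ 2) + r / 2.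
    by rewrite /c1 -rS; field; rewrite rn gt_eqF.
  have -> : c1 * u w + c3 = c1 * (u w + K ^+ 2 * hh) + r / 2 by rewrite /c3; ring.
  by rewrite lerD2r ler_pM2l.
rewrite unlock.
apply: (@le_trans _ _ (\int[P]_w (c1 * u w + c3)%:E)%E).
  apply: ge0_le_integral => //.
  - by move=> w _; rewrite lee_fin.
  - by apply/measurable_EFinP; exact: min_grad_measurable.
  - by apply/measurable_EFinP; apply: measurable_funD => //; exact: measurable_funM.
  - by move=> w _; rewrite lee_fin.
under eq_integral do rewrite EFinD EFinM.
rewrite ge0_integralD//; last 2 first.
- by move=> w _; rewrite mule_ge0// lee_fin// ltW.
- by apply/measurable_EFinP; exact: measurable_funM.
rewrite ge0_integralZl//; last 3 first.
- by apply/measurable_EFinP.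
- by move=> w _; rewrite lee_fin.
- by rewrite lee_fin ltW.
rewrite integral_cst//= probability_setT mule1.
apply: (@le_trans _ _ (c1%:E * (a^-1 * Delta)%:E + c3%:E)%E).
  by rewrite leeD2r// lee_pmul2l// ?lte_fin//; exact: phi_sum.
rewrite -EFinM -EFinD lee_fin.
have rn : r != 0 by rewrite gt_eqF.
have an : a != 0 by rewrite gt_eqF// descent_const_gt0.
have -> : c1 * (a^-1 * Delta) + c3 =
    (1 / k.+1%:R * a^-1 * Delta + K ^+ 2 * hh / k.+1%:R) / (2 * r) + r / 2.
  by rewrite /c3 /c1; field; rewrite an rn gt_eqF.
apply: (@le_trans _ _ (S / (2 * r) + r / 2)).
  by rewrite lerD2r ler_pM2r// invr_gt0 mulr_gt0.
by rewrite -rS le_eqVlt; apply/orP; left; apply/eqP; field.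
Qed.

End expected_descent.

(** * The convergence rate *)

Theorem theorem8 (R : realType) (n m d : nat)
    (d_gt0 : (0 < d)%N) (m_gt0 : (0 < m)%N) (m_even : ~~ odd m)
    (d_lt_n : (d < n)%N) (m_lt_n : (m < n)%N)
    (f : 'cV[R]_n -> R) (f_C2 : classC2 f)
    (fstar : R) (f_bounded : has_lbound (range f))
    (fstar_inf : fstar = inf (range f))
    (beta c M1 M2 : R)
    (beta01 : 0 < beta < 1) (c01 : 0 < c < 1)
    (M1_gt0 : 0 < M1) (M1_le_M2 : M1 <= M2)
    (C0 C : R) (C0_gt0 : 0 < C0) (C_gt0 : 0 < C)
    (C0C : gaussian_constants n d C0 C)
    (c_lt_half : c < 1 / 2)
    (L : R) (L_gt0 : 0 < L)
    (grad_lip : forall u v : 'cV[R]_n,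
       enorm (grad f u - grad f v) <= L * enorm (u - v))
    (x0 : 'cV[R]_n)
    (H0 : 'M[R]_m) (H0_bounds : spectral_bounds M1 M2 H0)
    (Pinit : 'M[R]_(n, m)) (Pinit_unit : forall j, enorm (col j Pinit) = 1)
    (disp : measure_display) (T : measurableType disp) (P : probability T R)
    (eps : R) (eps01 : 0 < eps < 1) (p_gt0 : 0 < good_prob d C0 eps) :
  let K := Kconst n m d C M1 M2 c L eps in
  let a := descent_const n m d C0 C M1 M2 beta c L eps in
  (forall (h : R) (x : nat -> T -> 'cV[R]_n), 0 < h ->
     fd_iterates P d f beta c M1 M2 (fun=> h) x0 H0 Pinit x ->
     forall k : nat,
       ('E_P[fun w => min_grad f (x^~ w) k] <=
        (Num.sqrt (1 / k.+1%:R * a^-1 * (f x0 - fstar) + K ^+ 2 * h ^+ 2))%:E)%E)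
  /\
  (forall (h : nat -> R) (x : nat -> T -> 'cV[R]_n), (forall k, 0 < h k) ->
     cvgn (series (fun j => h j ^+ 2)) ->
     fd_iterates P d f beta c M1 M2 h x0 H0 Pinit x ->
     (forall k : nat,
        ('E_P[fun w => min_grad f (x^~ w) k] <=
         (Num.sqrt (1 / k.+1%:R * a^-1 * (f x0 - fstar) +
            K ^+ 2 * limn (series (fun j => h j ^+ 2)) / k.+1%:R))%:E)%E)
     /\
     (fun k => fine 'E_P[fun w => min_grad f (x^~ w) k] : R^o)
       =O_\oo (fun k => Num.sqrt (1 / k%:R) : R^o)).
Proof.
have m_ge2 : (1 < m)%N by rewrite ltn_neqAle m_gt0 andbT; apply: contraNneq m_even => <-.
have n_gt0 : (0 < n)%N := leq_ltn_trans (leq0n d) d_lt_n.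
case/andP: (c01) => c_gt0 _ K a.
have K0 : 0 < K by exact: Kconst_gt0.
have a0 : 0 < a by exact: descent_const_gt0.
have D0 : 0 <= f x0 - fstar.
  by rewrite subr_ge0 fstar_inf; apply: ge_inf => //; exists x0.
have bound (h : nat -> R) x (h_gt0 : forall k, 0 < h k)
    (x_run : fd_iterates P d f beta c M1 M2 h x0 H0 Pinit x) k S : 0 < S ->
    1 / k.+1%:R * a^-1 * (f x0 - fstar)
      + K ^+ 2 * (\sum_(j < k.+1) h j ^+ 2) / k.+1%:R <= S ->
    ('E_P[fun w => min_grad f (x^~ w) k] <= (Num.sqrt S)%:E)%E.
  move=> S0 hS; apply: (mean_min_grad d_gt0 m_ge2 n_gt0 f_C2 f_bounded beta01 c_gt0
    c_lt_half M1_gt0 M1_le_M2 C_gt0 C0C L_gt0 grad_lip eps01 p_gt0 H0_bounds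
    Pinit_unit h_gt0 x_run) => //.
  by rewrite -fstar_inf.
have main0 k : 0 <= 1 / k.+1%:R * a^-1 * (f x0 - fstar).
  by rewrite mulr_ge0// mulr_ge0 ?invr_ge0 ?(ltW a0)// divr_ge0.
split=> [h x h_gt0 x_run k|h x h_gt0 h_cvg x_run].
  apply: (bound (fun=> h) x) => //.
    by rewrite ltr_wpDl// mulr_gt0 ?exprn_gt0.
  have -> : \sum_(j < k.+1) h ^+ 2 = h ^+ 2 * k.+1%:R.
    by rewrite sumr_const card_ord mulr_natr.
  by rewrite [X in _ + X / _]mulrA mulfK.
set H2 := limn _.
have series_nd : nondecreasing_seq (series (fun j => h j ^+ 2)).
  by apply: nondecreasing_series => j _ _; exact: sqr_ge0.
have sum_le k : \sum_(j < k.+1) h j ^+ 2 <= H2.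
  have := nondecreasing_cvgn_le series_nd h_cvg k.+1.
  by rewrite /series/= big_mkord.
have H2_gt0 : 0 < H2.
  apply: lt_le_trans (sum_le 0%N); rewrite big_ord_recl big_ord0 addr0.
  exact: exprn_gt0.
have rate k : ('E_P[fun w => min_grad f (x^~ w) k] <=
   (Num.sqrt (1 / k.+1%:R * a^-1 * (f x0 - fstar) + K ^+ 2 * H2 / k.+1%:R))%:E)%E.
  apply: (bound h x) => //.
    by rewrite ltr_wpDl// divr_gt0// mulr_gt0 ?exprn_gt0.
  by rewrite lerD2l ler_pM2r ?invr_gt0// ler_pM2l ?exprn_gt0.
split=> //; apply/eqO_exP.
pose B := a^-1 * (f x0 - fstar) + K ^+ 2 * H2.
have B_gt0 : 0 < B.
  apply: ltr_wpDl; last by rewrite mulr_gt0// exprn_gt0.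
  by rewrite mulr_ge0// invr_ge0 ltW.
exists (Num.sqrt B); first by rewrite sqrtr_gt0.
exists 1%N => // k /= k_gt0.
set E := ('E_P[_])%E.
have E0 : (0 <= E)%E by apply: expectation_ge0 => w; exact: min_grad_ge0.
have Efin : E \is a fin_num.
  by rewrite ge0_fin_numE// (le_lt_trans (rate k))// ltry.
rewrite [`|fine E|]ger0_norm ?fine_ge0// [`|Num.sqrt _|]ger0_norm ?sqrtr_ge0//.
rewrite -sqrtrM ?(ltW B_gt0)//.
have := rate k; rewrite -/E -(fineK Efin) lee_fin => /le_trans; apply.
rewrite ler_wsqrtr//.
have -> : 1 / k.+1%:R * a^-1 * (f x0 - fstar) + K ^+ 2 * H2 / k.+1%:R = B / k.+1%:R.
  have kn : k.+1%:R != 0 :> R by rewrite pnatr_eq0.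
  have an : a != 0 by rewrite gt_eqF.
  rewrite /B; move: k.+1%:R kn => t tn; field.
  by rewrite an tn.
by rewrite div1r ler_pM2l// lef_pV2 ?posrE ?ltr0n// ler_nat.
Qed.
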